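(* Let $\{\sigma,\tau\}$ be any of the pairs $\{123,213\},\{132,213\},\{132,231\},\{132,312\},\{213,231\},\{213,312\},\{231,312\},\{231,321\},\{312,321\}$. Then for every $n$ and every $F\in\mathcal{F}_n$, $$|\mathcal{M}_F(\sigma,\tau)|=2^{\,n-r(F)},$$ so all these pairs are shape-Wilf-equivalent. Moreover $$\sum_{n\ge0}|\mathcal{M}_n(\sigma,\tau)|z^n=\frac{4}{3+\sqrt{1-8z}},\qquad |\mathcal{M}_{n+1}(\sigma,\tau)|=\frac{1}{n+1}\sum_{k=0}^{n}\binom{2n+2}{n-k}\binom{n+k}{k}\ (n\ge0),$$ and $$\sum_{n\ge0}|\mathcal{P}_n(\sigma,\tau)|z^n=\frac{2-3z+z^2-z\sqrt{1-6z+z^2}}{2(1-3z+3z^2)}.$$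
   Context: A Dyck path of semilength $n$ is a lattice path from $(0,n)$ to $(n,0)$ with unit east and south steps never going strictly below $y=n-x$. $\mathcal{F}_n$ is the set of Ferrers boards whose border $D_F$ is such a path. $r(F)$ is the number of returns of $D_F$: the number of its south steps that end on the line $y=n-x$. Perfect matchings of $[2n]$: sets of $n$ disjoint pairs $(i,j)$, $i<j$ ($i$ opener, $j$ closer). The shape of $M$ is the board in $\mathcal{F}_n$ whose border is obtained reading $1,\dots,2n$ and taking an east step per opener and a south step per closer. $M$ avoids $\tau\in S_k$ if there are no $i_1<\dots<i_{2k}$ with all pairs $(i_a,i_{2k+1-\tau(a)})$ in $M$. $\mathcal{M}_F(\sigma,\tau)$ (resp. $\mathcal{M}_n(\sigma,\tau)$) is the set of perfect matchings of shape $F$ (resp. of $[2n]$) avoiding both $\sigma$ and $\tau$. Pairs $\{\sigma,\tau\}$, $\{\sigma',\tau'\}$ are shape-Wilf-equivalent if $|\mathcal{M}_F(\sigma,\tau)|=|\mathcal{M}_F(\sigma',\tau')|$ for every Ferrers board $F$. Set partitions of $[n]$: for each block $\{i_1<\dots<i_a\}$ draw arcs $(i_1,i_2),\dots,(i_{a-1},i_a)$; a partition avoids $\tau\in S_k$ if there are no $i_1<\dots<i_{2k}$ with all arcs $(i_a,i_{2k+1-\tau(a)})$ present. $\mathcal{P}_n(\sigma,\tau)$ is the set of partitions of $[n]$ avoiding both. *)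

(* Defs.v *)
From HB Require Import structures.
From mathcomp Require Import all_boot all_order all_algebra all_fingroup.
From mathcomp Require Import boolp.

Set Implicit Arguments.
Unset Strict Implicit.
Unset Printing Implicit Defensive.

Import GRing.Theory.

Definition step := bool.
Definition east : step := true.
Definition south : step := false.

(* The point reached from (0, n) after the first k steps of w.  The truncated
   subtraction is harmless for words with at most n south steps. *)
Definition path_point n (w : seq step) k : nat * nat :=
  (count_mem east (take k w), n - count_mem south (take k w)).

Definition dyck_path n (w : seq step) : bool :=
  [&& count_mem east w == n, count_mem south w == n
    & all (fun k => n <= (path_point n w k).1 + (path_point n w k).2)
          (iota 0 (size w).+1)].

Definition returns n (w : seq step) : nat :=
  count (fun k => (nth east w k == south) &&
                  ((path_point n w k.+1).1 + (path_point n w k.+1).2 == n))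
        (iota 0 (size w)).

(* The pair (i, j) stands for the unit square [i, i+1] x [j, j+1]. *)
Definition board n := {set 'I_n * 'I_n}.

Definition is_ferrers n (F : board n) : bool :=
  [forall c in F, forall d : 'I_n * 'I_n,
     (d.1 <= c.1) && (d.2 <= c.2) ==> (d \in F)].

(* The height at which the border arrives on the line x = i: n at the starting
   point, then the height of the column with index i - 1. *)
Definition arrival_height n (F : board n) (i : nat) : nat :=
  if i is i'.+1 then #|[set c in F | c.1 == i' :> nat]| else n.

(* The border of F as a path from (0, n) to (n, 0): on the line x = i it goes
   down to the top of column i, which it then follows eastwards. *)
Definition border n (F : board n) : seq step :=
  flatten [seq rcons (nseq (arrival_height F i - arrival_height F i.+1) south)
                     east | i <- iota 0 n]
  ++ nseq (arrival_height F n) south.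

Definition ferrers_boards n : {set board n} :=
  [set F : board n | is_ferrers F && dyck_path n (border F)].

Definition board_returns n (F : board n) : nat := returns n (border F).

Definition arcs m := {set 'I_m * 'I_m}.

Definition one_line k (tau : 'S_k) : seq nat :=
  [seq (tau i).+1 | i <- enum 'I_k].

(* With indices starting from 0, i_(2k+1-tau(a)) is the element of index
   2k - 1 - tau a, i.e. the image under f of the reversal of tau a. *)
Definition contains m k (A : arcs m) (tau : 'S_k) : bool :=
  [exists f : {ffun 'I_(k + k) -> 'I_m},
     [forall a : 'I_(k + k), forall b : 'I_(k + k), (a < b) ==> (f a < f b)] &&
     [forall a : 'I_k, (f (lshift k a), f (rev_ord (lshift k (tau a)))) \in A]].

Definition avoids m k (A : arcs m) (tau : 'S_k) : bool := ~~ contains A tau.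

Definition disjoint_arcs m (p q : 'I_m * 'I_m) : bool :=
  [disjoint [set p.1; p.2] & [set q.1; q.2]].

(* The ground set [2n] is represented by 'I_(n + n), i.e. starting from 0. *)
Definition perfect_matching n (M : arcs (n + n)) : bool :=
  [&& #|M| == n,
      [forall p in M, p.1 < p.2]
    & [forall p in M, forall q in M, (p != q) ==> disjoint_arcs p q]].

Definition is_opener m (M : arcs m) (i : 'I_m) : bool :=
  [exists p in M, p.1 == i].

Definition matching_word n (M : arcs (n + n)) : seq step :=
  [seq if is_opener M i then east else south | i <- enum 'I_(n + n)].

Definition has_shape n (M : arcs (n + n)) (F : board n) : bool :=
  (F \in ferrers_boards n) && (border F == matching_word M).

Definition matchings k n (sigma tau : 'S_k) : {set arcs (n + n)} :=
  [set M | [&& perfect_matching M, avoids M sigma & avoids M tau]].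

Definition shape_matchings k n (F : board n) (sigma tau : 'S_k) :
    {set arcs (n + n)} :=
  [set M in matchings n sigma tau | has_shape M F].

Definition shape_Wilf_equivalent k (sigma tau sigma' tau' : 'S_k) : Prop :=
  forall n (F : board n), is_ferrers F ->
    #|shape_matchings F sigma tau| = #|shape_matchings F sigma' tau'|.

Definition partition_arcs n (P : {set {set 'I_n}}) : arcs n :=
  [set p : 'I_n * 'I_n | (p.1 < p.2) &&
     [exists B in P, [&& p.1 \in B, p.2 \in B
        & [forall l in B, ~~ (p.1 < l < p.2)]]]].

Definition partitions k n (sigma tau : 'S_k) : {set {set {set 'I_n}}} :=
  [set P | [&& partition P [set: 'I_n], avoids (partition_arcs P) sigma
             & avoids (partition_arcs P) tau]].

Definition listed_pairs : seq (seq nat * seq nat) :=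
  [:: ([:: 1; 2; 3], [:: 2; 1; 3]); ([:: 1; 3; 2], [:: 2; 1; 3]);
      ([:: 1; 3; 2], [:: 2; 3; 1]); ([:: 1; 3; 2], [:: 3; 1; 2]);
      ([:: 2; 1; 3], [:: 2; 3; 1]); ([:: 2; 1; 3], [:: 3; 1; 2]);
      ([:: 2; 3; 1], [:: 3; 1; 2]); ([:: 2; 3; 1], [:: 3; 2; 1]);
      ([:: 3; 1; 2], [:: 3; 2; 1])].

Local Open Scope ring_scope.

(* Sequences defined by course-of-values recursion: the n-th term is computed
   by F from the list of the n preceding terms. *)
Section CourseOfValues.
Variable F : seq rat -> rat.

Fixpoint cov_prefix n : seq rat :=
  if n is n'.+1 then rcons (cov_prefix n') (F (cov_prefix n')) else [::].

Definition cov_rec n : rat := F (cov_prefix n).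

Lemma size_cov_prefix n : size (cov_prefix n) = n.
Proof. by elim: n => //= n IHn; rewrite size_rcons IHn. Qed.

Lemma nth_cov_prefix n i : (i < n)%N -> (cov_prefix n)`_i = cov_rec i.
Proof.
elim: n => // n IHn; rewrite ltnS leq_eqVlt /= nth_rcons size_cov_prefix.
by case/predU1P=> [->|lt_in]; [rewrite ltnn eqxx | rewrite lt_in IHn].
Qed.

End CourseOfValues.

(* The formal power series over rat. *)
Record fps := Fps { coef : nat -> rat }.

Lemma fpsP (f g : fps) : (forall n, coef f n = coef g n) <-> f = g.
Proof.
split=> [|-> //]; case: f g => [f] [g] /= eq_fg.
by congr Fps; apply/funext.
Qed.

HB.instance Definition _ := gen_eqMixin fps.
HB.instance Definition _ := gen_choiceMixin fps.

Definition fps_const c := Fps (fun n => if n == 0%N then c else 0).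
Definition fps_opp f := Fps (fun n => - coef f n).
Definition fps_add f g := Fps (fun n => coef f n + coef g n).
Definition fps_mul f g :=
  Fps (fun n => \sum_(i < n.+1) coef f i * coef g (n - i)).

Fact fps_addA : associative fps_add.
Proof. by move=> f g h; apply/fpsP=> n /=; rewrite addrA. Qed.
Fact fps_addC : commutative fps_add.
Proof. by move=> f g; apply/fpsP=> n /=; rewrite addrC. Qed.
Fact fps_add0 : left_id (fps_const 0) fps_add.
Proof. by move=> f; apply/fpsP=> n /=; rewrite if_same add0r. Qed.
Fact fps_addN : left_inverse (fps_const 0) fps_opp fps_add.
Proof. by move=> f; apply/fpsP=> n /=; rewrite if_same addNr. Qed.

HB.instance Definition _ :=
  GRing.isZmodule.Build fps fps_addA fps_addC fps_add0 fps_addN.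

Definition truncate N (f : fps) : {poly rat} := \poly_(i < N) coef f i.

Lemma coef_fps_mul N f g n : (n < N)%N ->
  coef (fps_mul f g) n = (truncate N f * truncate N g)`_n.
Proof.
move=> lt_nN; rewrite coefM /=; apply: eq_bigr => i _; rewrite !coef_poly.
by rewrite !(leq_ltn_trans _ lt_nN) ?leq_subr // -ltnS.
Qed.

Fact fps_mulC : commutative fps_mul.
Proof.
by move=> f g; apply/fpsP=> n; rewrite !(@coef_fps_mul n.+1) // mulrC.
Qed.

Fact fps_mulA : associative fps_mul.
Proof.
move=> f g h; apply/fpsP=> n; set N := n.+1.
transitivity ((truncate N f * truncate N g * truncate N h)`_n).
  rewrite -mulrA coefM /=; apply: eq_bigr => i _.
  rewrite -(@coef_fps_mul N) ?ltnS ?leq_subr //.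
  by rewrite coef_poly ltn_ord.
rewrite coefM /=; apply: eq_bigr => i _.
by rewrite -(@coef_fps_mul N) ?ltn_ord // coef_poly ltnS leq_subr.
Qed.

Fact fps_mul1 : left_id (fps_const 1) fps_mul.
Proof.
move=> f; apply/fpsP=> n /=; rewrite big_ord_recl /= mul1r subn0.
by rewrite big1 ?addr0 // => i _; rewrite mul0r.
Qed.

Fact fps_mulDl : left_distributive fps_mul fps_add.
Proof.
move=> f g h; apply/fpsP=> n /=; rewrite -big_split /=.
by apply: eq_bigr => i _; rewrite mulrDl.
Qed.

Fact fps_1neq0 : fps_const 1 != 0.
Proof. by apply/eqP=> /fpsP/(_ 0%N)/eqP; rewrite oner_eq0. Qed.

HB.instance Definition _ := GRing.Zmodule_isComNzRing.Build fps
  fps_mulA fps_mulC fps_mul1 fps_mulDl fps_1neq0.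

Lemma fps_coefM f g n :
  coef (f * g) n = \sum_(i < n.+1) coef f i * coef g (n - i).
Proof. by []. Qed.

Lemma fps_coef1 n : coef 1 n = (n == 0%N)%:R.
Proof. by case: n. Qed.

Definition fps_unit : {pred fps} := [pred f | coef f 0 != 0].

(* Obtained by solving (f * g)_n = (1)_n for g_n. *)
Definition inv_step (f : fps) (s : seq rat) : rat :=
  let n := size s in
  ((n == 0%N)%:R - \sum_(i < n) s`_i * coef f (n - i)) / coef f 0.

Definition fps_inv f : fps :=
  if f \in fps_unit then Fps (cov_rec (inv_step f)) else f.

Fact fps_mulVf : {in fps_unit, left_inverse 1 fps_inv *%R}.
Proof.
move=> f f_unit; apply/fpsP=> n; rewrite fps_coefM fps_coef1 /fps_inv f_unit /=.
rewrite big_ord_recr /= subnn {2}/cov_rec /inv_step size_cov_prefix divfK //.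
rewrite addrC -addrA [- _ + _]addrC.
under eq_bigr => i _ do rewrite -(nth_cov_prefix _ (ltn_ord i)).
by rewrite subrr addr0.
Qed.

Fact fps_unitPl f g : g * f = 1 -> f \in fps_unit.
Proof.
move/fpsP/(_ 0%N)/eqP; rewrite fps_coefM fps_coef1 big_ord1 /= subn0 => eq1.
by apply: contraTneq eq1 => /= ->; rewrite mulr0 eq_sym oner_eq0.
Qed.

Fact fps_inv_out : {in [predC fps_unit], fps_inv =1 id}.
Proof. by move=> f; rewrite inE /fps_inv => /negPf->. Qed.

HB.instance Definition _ := GRing.ComNzRing_hasMulInverse.Build fps
  fps_mulVf fps_unitPl fps_inv_out.

Lemma fps_unitE (f : fps) : (f \is a GRing.unit) = (coef f 0 != 0).
Proof. by []. Qed.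

(* Obtained by solving (g ^+ 2)_n = f_n for g_n, starting from g_0 = 1. *)
Definition sqrt_step (f : fps) (s : seq rat) : rat :=
  let n := size s in
  if n == 0%N then 1
  else (coef f n - \sum_(1 <= i < n) s`_i * s`_(n - i)) / 2.

(* The square root with constant term 1 of a series with constant term 1. *)
Definition fps_sqrt (f : fps) : fps := Fps (cov_rec (sqrt_step f)).

Lemma fps_sqrt0 f : coef (fps_sqrt f) 0 = 1.
Proof. by []. Qed.

Lemma fps_sqrtK f : coef f 0 = 1 -> fps_sqrt f ^+ 2 = f.
Proof.
move=> f0; apply/fpsP=> -[|n]; rewrite expr2 fps_coefM.
  by rewrite big_ord1 fps_sqrt0 mulr1 f0.
rewrite -(big_mkord xpredT
  (fun i => coef (fps_sqrt f) i * coef (fps_sqrt f) (n.+1 - i))).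
rewrite big_nat_recr //= big_nat_recl //= subnn subn0.
rewrite [cov_rec _ 0]/cov_rec /= mul1r mulr1 addrAC -mulr2n.
have -> : cov_rec (sqrt_step f) n.+1 *+ 2 = coef f n.+1 -
    \sum_(1 <= i < n.+1) (cov_prefix (sqrt_step f) n.+1)`_i
                         * (cov_prefix (sqrt_step f) n.+1)`_(n.+1 - i).
  by rewrite {1}/cov_rec {1}/sqrt_step size_cov_prefix -[LHS]mulr_natr divfK.
rewrite big_add1 -addrA addrC.
rewrite [X in - X + _](_ : _ = \sum_(0 <= i < n)
   cov_rec (sqrt_step f) i.+1 * cov_rec (sqrt_step f) (n.+1 - i.+1)).
  by rewrite addNr add0r.
apply: eq_big_nat => i /andP[_ lt_in].
by rewrite !nth_cov_prefix ?ltnS ?subSS ?leq_subr.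
Qed.

Definition fps_X : fps := Fps (fun n => (n == 1%N)%:R).

Definition ogf (a : nat -> nat) : fps := Fps (fun n => (a n)%:R).

(* Main.v *)
(* Reading an arc diagram from left to right, each closer picks one of the open
   arcs, and an occurrence of a pattern of length 3 is a triple of simultaneously
   open arcs closed in a forbidden order.  Delete the arc that is closed first,
   when h arcs are open.  For 6 of the 9 pairs, each avoiding diagram left by
   this deletion can be completed in exactly min(h, 2) ways: the forbidden orders
   single out two ranks for the deleted arc among the h - 1 others.  The 3
   remaining pairs are obtained by reversal, which inverts the patterns.  Hence
   the number of avoiding diagrams with given sets of openers and closers is the
   product over the closers of min(h, 2); for a Dyck path this is 2^(n - r).

   A partition is turned into such a diagram by the arcs joining consecutive
   elements of its blocks, a point being both a closer and an opener when it is
   neither the first nor the last of its block.  Summing the products over all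
   words gives the generating functions G_e of the paths that start at height e;
   they satisfy a linear system that determines them, and whose solution is
   geometric in e for e >= 1.

   For matchings, (1 + z) M(z) = (3 - sqrt(1 - 8z)) / 2, so that the sum of two
   consecutive terms is 2^(n+1) times a Catalan number.  The binomial sum satisfies
   the same recurrence, by telescoping. *)
Require Import Defs.
From mathcomp Require Import all_boot all_order all_algebra all_fingroup.
From mathcomp Require Import zify ring.

Set Implicit Arguments.
Unset Strict Implicit.
Unset Printing Implicit Defensive.

Import GRing.Theory Num.Theory.

(** * Sequences of closings *)

(** [x], [y], [z] are the ranks of the openers of three arcs, listed in the order of their closers.
    In an occurrence of [t] the opener carrying the entry [a] is closed at index [3 - a], counted
    from 0, so these ranks have to increase along [t]. *)
Definition closes_as (t : seq nat) (x y z : nat) : bool :=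
  sorted ltn [seq nth 0 [:: x; y; z] (3 - a) | a <- t].

Section ClosingSequences.

Variable bad : nat -> nat -> nat -> bool.

Let ok x : rel nat := fun y z => ~~ bad x y z.

(** [s] lists the ranks of the openers picked by the successive closers, and [h] the number of
    openers before each closer. The filter [y < b] keeps the later arcs that are already open when
    [x] is closed. *)
Fixpoint valid (h s : seq nat) : bool :=
  match h, s with
  | [::], [::] => true
  | b :: h', x :: s' =>
    [&& x < b, x \notin s', pairwise (ok x) [seq y <- s' | y < b] & valid h' s']
  | _, _ => false
  end.

(** After [d] closings, [b - d] arcs are open at a closer preceded by [b] openers. *)
Fixpoint choices (d : nat) (h : seq nat) : nat :=
  if h is b :: h' then minn (b - d) 2 * choices d.+1 h' else 1.

Lemma choices_pred d h : choices d (map predn h) = choices d.+1 h.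
Proof. by elim: h d => //= b h IHh d; rewrite IHh; congr (minn _ _ * _); lia. Qed.

Lemma valid_size h s : valid h s -> size s = size h.
Proof. by elim: h s => [|b h IHh] [|x s] //= /and4P[_ _ _ /IHh->]. Qed.

Lemma valid_uniq h s : valid h s -> uniq s.
Proof. by elim: h s => [|b h IHh] [|x s] //= /and4P[_ -> _ /IHh->]. Qed.

Lemma valid_bounded K h s : all (leq^~ K) h -> valid h s -> all (ltn^~ K) s.
Proof.
elim: h s => [|b h IHh] [|x s] //= /andP[leb /IHh IH] /and4P[ltx _ _ /IH->].
by rewrite (leq_trans ltx).
Qed.

Lemma valid_perm h s :
  all (leq^~ (size h)) h -> valid h s -> perm_eq s (iota 0 (size h)).
Proof.
move=> leh vs; apply: uniq_perm; rewrite ?iota_uniq ?(valid_uniq vs) //.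
have sub : {subset s <= iota 0 (size h)}.
  by move=> y /(allP (valid_bounded leh vs)); rewrite mem_iota.
have [] // := uniq_min_size (valid_uniq vs) sub.
by rewrite size_iota (valid_size vs).
Qed.

Hypothesis bad_bump : forall x a b c,
  bad (bump x a) (bump x b) (bump x c) = bad a b c.

(** [p] is the order in which the other [m.+1] open arcs get closed; the only information used about
    it is the constraint imposed by its first element. *)
Hypothesis two_insertions : forall m p, perm_eq p (iota 0 m.+1) ->
  pairwise (ok (head 0 p)) (behead p) ->
  count (fun x => pairwise (ok x) (map (bump x) p)) (iota 0 m.+2) = 2.

Lemma bumpI x : injective (bump x).
Proof. exact: can_inj (bumpK x). Qed.

Lemma bump_lt_pred x b y : x < b -> (bump x y < b) = (y < b.-1).
Proof. by rewrite /bump; case: leqP; lia. Qed.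

Lemma valid_bump x h s :
  all (ltn x) h -> valid h (map (bump x) s) = valid (map predn h) s.
Proof.
elim: h s => [|b h IHh] [|y s] //= /andP[ltx /IHh->].
rewrite bump_lt_pred // (mem_map (@bumpI x)) filter_map pairwise_map.
congr [&& _, _, _ & _].
rewrite (eq_filter (a2 := ltn^~ b.-1)); last by move=> z /=; rewrite bump_lt_pred.
by apply: eq_pairwise => u v; rewrite /ok /= bad_bump.
Qed.

(** Ranks below [m] are open from the first closer on. Hence the first of them to be closed sees all
    the others open, and its own validity condition covers them. *)
Lemma valid_head_ok m h s : all (leq m) h -> valid h s ->
  let p := [seq y <- s | y < m] in pairwise (ok (head 0 p)) (behead p).
Proof.
elim: h s => [|b h IHh] [|y s] //= /andP[leb /IHh IH] /and4P[_ _ ok_s vs].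
case: ifP => _ /=; last exact: IH.
have -> : [seq z <- s | z < m] = [seq z <- [seq z <- s | z < b] | z < m].
  by rewrite -filter_predI; apply: eq_filter => z /=; case: ltnP => //; lia.
exact: pairwise_filter.
Qed.

(** Induction on the number of closers: a valid sequence is a first rank [x] followed by a valid
    sequence for the heights lowered by one, relabelled by [bump x] so as to skip [x]. The number of
    admissible [x] depends only on the first height. *)
Lemma valid_enum h : sorted leq h -> all (leq^~ (size h)) h ->
  exists l : seq (seq nat),
    [/\ uniq l, forall s, (s \in l) = valid h s & size l = choices 0 h].
Proof.
elim: {h}(size h) {-2}h (erefl (size h)) => [|k IHk] [|b h] //= => [_ _ _|[sz]].
  by exists [:: [::]]; split=> // -[|x s].
(* Height 0 at the first closer leaves no arc to close, in agreement with the factor [minn 0 2]. *)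
move=> srt /andP[leb leh]; case: b srt leb => [|m] srt leb.
  by exists [::]; split=> // -[|x s] //=; rewrite ltn0.
have geh : all (leq m.+1) h by apply: order_path_min srt => ? ? ?; apply: leq_trans.
have [|||l [uniq_l mem_l sz_l]] := IHk (map predn h).
- by rewrite size_map.
- rewrite sorted_map; apply: sub_sorted (path_sorted srt) => u v /=; lia.
- apply/allP=> _ /mapP[v /(allP leh) lev ->]; rewrite size_map; move: lev => /=; lia.
pose ch s := [seq x <- iota 0 m.+1 |
  pairwise (ok x) [seq y <- map (bump x) s | y < m.+1]].
exists [seq x :: map (bump x) s | s <- l, x <- ch s]; split.
- apply: allpairs_uniq_dep => // [s _|].
    by rewrite filter_uniq ?iota_uniq.
  move=> [s x] [s' x'] _ _ /= [<- eq_s].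
  by move: (inj_map (@bumpI x) eq_s) => ->.
- case=> [|x s].
    by apply/negbTE/allpairsPdep=> -[? [? []]].
  apply/allpairsPdep/and4P => [[s' [x' [s'l]]]|[ltx xs ok_s vs]].
    rewrite mem_filter mem_iota => /andP[ok_s' ltx'] [-> ->].
    split=> //; first by apply/mapP=> -[y _ /eqP]; rewrite (negPf (neq_bump _ _)).
    rewrite valid_bump -?mem_l //; apply: sub_all geh => v /=; lia.
  have sE : s = map (bump x) (map (unbump x) s).
    rewrite -map_comp map_id_in // => y ys /=; apply: unbumpK.
    by rewrite inE; apply: contraNneq xs => <-.
  exists (map (unbump x) s), x; split; last by rewrite -sE.
    rewrite mem_l -(@valid_bump x) -?sE //; apply: sub_all geh => v /=; lia.
  by rewrite mem_filter mem_iota -sE ok_s.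
rewrite size_allpairs_dep.
have /all_pred1P-> : all (pred1 (minn m.+1 2)) [seq size (ch s) | s <- l].
  rewrite all_map; apply/allP=> s; rewrite mem_l => vs /=.
  have chE x : x < m.+1 -> [seq y <- map (bump x) s | y < m.+1]
      = map (bump x) [seq y <- s | y < m].
    move=> ltx; rewrite filter_map; congr map; apply: eq_filter => y /=.
    exact: bump_lt_pred.
  rewrite size_filter (eq_in_count (a2 := fun x =>
    pairwise (ok x) (map (bump x) [seq y <- s | y < m]))); last first.
    by move=> x; rewrite mem_iota /= => /chE->.
  (* With a single open arc there is one candidate and nothing to compare it with; otherwise there
     are exactly two. *)
  case: m leb geh {srt ch chE} => [|m] leb geh.
    by rewrite (eq_filter (a2 := pred0)) // filter_pred0.
  rewrite two_insertions //.
    have leh' : all (leq^~ (size (map predn h))) (map predn h).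
      apply/allP=> _ /mapP[v /(allP leh) lev ->].
      by rewrite size_map; move: lev => /=; lia.
    apply: uniq_perm; rewrite ?filter_uniq ?iota_uniq ?(valid_uniq vs) // => y.
    rewrite mem_filter (perm_mem (valid_perm leh' vs)) !mem_iota size_map /=; lia.
  apply: valid_head_ok vs; apply/allP=> _ /mapP[v /(allP geh) gev ->].
  move: gev => /=; lia.
rewrite sumn_nseq size_map sz_l subn0 choices_pred; lia.
Qed.

End ClosingSequences.

(** * The six pairs handled without reversal *)

Definition closes_badly (s t : seq nat) (x y z : nat) : bool :=
  closes_as s x y z || closes_as t x y z.

Lemma pairwise_or (T : eqType) (r : rel T) (p : seq T) u v :
  pairwise r p -> u \in p -> v \in p -> u != v -> r u v || r v u.
Proof.
elim: p => //= x p IHp /andP[/allP rx /IHp IH]; rewrite !inE.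
case/predU1P=> [->|up] /predU1P[->|vp] neq; first by rewrite eqxx in neq.
- by rewrite rx.
- by rewrite rx ?orbT.
- exact: IH.
Qed.

Definition direct_pairs : seq (seq nat * seq nat) :=
  [:: ([:: 1; 2; 3], [:: 2; 1; 3]); ([:: 1; 3; 2], [:: 2; 1; 3]);
      ([:: 1; 3; 2], [:: 2; 3; 1]); ([:: 2; 1; 3], [:: 3; 1; 2]);
      ([:: 2; 3; 1], [:: 3; 1; 2]); ([:: 3; 1; 2], [:: 3; 2; 1])].

Lemma closes_badly_bump s t : (s, t) \in direct_pairs -> forall x a b c,
  closes_badly s t (bump x a) (bump x b) (bump x c) = closes_badly s t a b c.
Proof.
have lt_bump x i j : (bump x i < bump x j) = (i < j) by rewrite !ltnNge leq_bump2.
rewrite /direct_pairs !inE => st x a b c; move: st.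
by do ![case/orP|move/eqP=> [-> ->]]; rewrite /closes_badly /closes_as /= !lt_bump.
Qed.

(** [a] and [b] pass because each constraint they impose holds outright or follows from the one
    imposed by [c], the first of the other arcs to be closed. Any other [x] fails on a pair [u], [v]
    that is bad in both orders, or that is bad with [u] equal to [c], which comes first anyway. *)
Lemma count_insertions (bad : nat -> nat -> nat -> bool) m c p a b :
  perm_eq (c :: p) (iota 0 m.+1) -> pairwise (fun u v => ~~ bad c u v) p ->
  [&& a != b, a <= m.+1 & b <= m.+1] ->
  (forall x u v, (x == a) || (x == b) -> u <= m -> v <= m -> u != v -> v != c ->
     (u == c) || (u != c) && ~~ bad c u v -> ~~ bad x (bump x u) (bump x v)) ->
  (forall x, x <= m.+1 -> x != a -> x != b ->
     exists u v, [/\ u <= m, v <= m, u != v, bad x (bump x u) (bump x v)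
       & (u == c) || bad x (bump x v) (bump x u)]) ->
  count (fun x => pairwise (fun u v => ~~ bad x u v) (map (bump x) (c :: p)))
    (iota 0 m.+2) = 2.
Proof.
move=> perm_p ok_p /and3P[neq_ab lea leb] good_ab bad_x.
have memp u : (u \in c :: p) = (u <= m) by rewrite (perm_mem perm_p) mem_iota.
have : uniq (c :: p) by rewrite (perm_uniq perm_p) iota_uniq.
rewrite cons_uniq => /andP[cNp uniq_p].
rewrite (@eq_in_count _ _ (predU (pred1 a) (pred1 b)) (iota 0 m.+2)) => [|x].
  have := count_predUI (pred1 a) (pred1 b) (iota 0 m.+2).
  rewrite (eq_count (a1 := predI _ _) (a2 := pred0)); last first.
    by move=> x /=; apply/negP=> /andP[/eqP-> /idPn].
  by rewrite count_pred0 addn0 !count_uniq_mem ?iota_uniq //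
    !mem_iota !add0n !ltnS lea leb => ->.
rewrite mem_iota pairwise_map => /= lex; apply/idP/idP => [ok_x|xab].
  apply: contraT; rewrite negb_or => /andP[xa xb].
  have [u [v [leu lev neq_uv bad1 bad2]]] := bad_x x lex xa xb.
  have up : u \in c :: p by rewrite memp.
  have vp : v \in c :: p by rewrite memp.
  case/predU1P: bad2 => [uc|bad2].
    move: ok_x vp => /andP[/allP ok_c _]; rewrite inE eq_sym -uc (negPf neq_uv).
    by move=> /ok_c /=; rewrite -uc bad1.
  have /= := @pairwise_or _ (relpre (bump x) (fun u v => ~~ bad x u v)) (c :: p)
    u v ok_x up vp neq_uv; by rewrite bad1 bad2.
have lep u : u \in p -> (u <= m) && (u != c).
  move=> up; rewrite -memp inE up orbT; by apply: contraNneq cNp => <-.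
apply/andP; split.
  apply/allP=> v vp /=; have /andP[lev vc] := lep v vp.
  have lec : c <= m by rewrite -memp mem_head.
  by apply: good_ab; rewrite ?eqxx // eq_sym.
have /(sub_in_pairwise (P := mem p)) : {in p &, subrel
    [rel u v | (u != v) && ~~ bad c u v] (relpre (bump x) (fun u v => ~~ bad x u v))}.
  move=> u v up vp /= /andP[neq_uv ok_uv].
  have /andP[leu uc] := lep u up; have /andP[lev vc] := lep v vp.
  by apply: good_ab; rewrite // uc ok_uv orbT.
apply; first exact/allP.
rewrite pairwise_relI -uniq_pairwise uniq_p; exact: ok_p.
Qed.

(** The pair [123], [213] forbids the deleted arc to have the largest rank of a triple, which leaves
    ranks 0 and 1; dually, [312], [321] leave [m] and [m.+1]. For the other pairs an admissible rank
    is either extreme, or adjacent to [c] and then subject to the same comparisons as [c]. *)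
Lemma two_insertions s t : (s, t) \in direct_pairs -> forall m p,
  perm_eq p (iota 0 m.+1) ->
  pairwise (fun y z => ~~ closes_badly s t (head 0 p) y z) (behead p) ->
  count (fun x => pairwise (fun y z => ~~ closes_badly s t x y z) (map (bump x) p))
    (iota 0 m.+2) = 2.
Proof.
move=> st m [|c p] perm_p ok_p; first by have := perm_size perm_p.
have lec : c <= m by have := perm_mem perm_p c; rewrite mem_head mem_iota.
move: st ok_p; rewrite /direct_pairs !inE.
do ![case/orP|move/eqP=> [-> ->]] => /= ok_p.
- apply: (count_insertions (a := 0) (b := 1) perm_p ok_p);
    rewrite /closes_badly /closes_as /= /bump; try lia.
  move=> x lex xa xb; exists 0, 1.
  split; lia.
- apply: (count_insertions (a := 0) (b := c.+1) perm_p ok_p);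
    rewrite /closes_badly /closes_as /= /bump; try lia.
  move=> x lex xa xb; exists c, (if c < x then x.-1 else 0).
  case: ltnP => ?; split; lia.
- apply: (count_insertions (a := 0) (b := m.+1) perm_p ok_p);
    rewrite /closes_badly /closes_as /= /bump; try lia.
  move=> x lex xa xb; exists c, (if c < x then m else 0).
  case: ltnP => ?; split; lia.
- apply: (count_insertions (a := c) (b := c.+1) perm_p ok_p);
    rewrite /closes_badly /closes_as /= /bump; try lia.
  move=> x lex xa xb; exists c, (if c < x then x.-1 else x).
  case: ltnP => ?; split; lia.
- apply: (count_insertions (a := c) (b := m.+1) perm_p ok_p);
    rewrite /closes_badly /closes_as /= /bump; try lia.
  move=> x lex xa xb; exists c, (if c < x then m else x).
  case: ltnP => ?; split; lia.
- apply: (count_insertions (a := m) (b := m.+1) perm_p ok_p);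
    rewrite /closes_badly /closes_as /= /bump; try lia.
  move=> x lex xa xb; exists m, m.-1.
  split; lia.
Qed.

(** * Words of openers and closers *)

Lemma pairwise_filterE (T : Type) (r : rel T) (P : pred T) (s : seq T) :
  pairwise r [seq y <- s | P y] = pairwise (fun y z => P y && P z ==> r y z) s.
Proof.
elim: s => //= y s IHs; case: (P y) => /=; rewrite IHs; last by rewrite all_predT.
by rewrite all_filter.
Qed.

(** The condition [nth 0 s j < nth 0 h i] says that the arc closed by the [j]-th closer was opened
    before the [i]-th one. *)
Lemma validP bad h s : reflect
  [/\ size s = size h, uniq s, forall i, i < size s -> nth 0 s i < nth 0 h i
    & forall i j l, i < j < l -> l < size s ->
      nth 0 s j < nth 0 h i -> nth 0 s l < nth 0 h i ->
      ~~ bad (nth 0 s i) (nth 0 s j) (nth 0 s l)]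
  (valid bad h s).
Proof.
elim: h s => [|b h IHh] [|x s] /=.
- by constructor.
- by constructor; case.
- by constructor; case.
rewrite pairwise_filterE; apply: (iffP and4P).
  case=> ltx xs /(pairwiseP 0) ok_s /IHh[sz_s uniq_s lt_s good_s]; split.
  - by rewrite sz_s.
  - by rewrite xs.
  - by case.
  case=> [|i] [|j] [|l] lt_ijl ltl lt3 lt4; rewrite ?ltn0 ?andbF // in lt_ijl;
    last exact: (good_s i j l).
  have := ok_s j l; rewrite !inE /= in lt3 lt4 *; rewrite lt3 lt4; apply=> //.
  by clear -lt_ijl ltl; lia.
case=> [[sz_s] /andP[xs uniq_s] lt_s good_s]; split=> //; first exact: (lt_s 0).
  apply/(pairwiseP 0) => j l; rewrite !inE => ltj ltl lt_jl.
  by apply/implyP=> /andP[? ?]; apply: (good_s 0 j.+1 l.+1).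
apply/IHh; split=> // [i|i j l]; first exact: (lt_s i.+1).
exact: (good_s i.+1 j.+1 l.+1).
Qed.

(** The components tell whether a point opens and whether it closes an arc; a point of a partition
    may do both or neither. *)
Definition letter := (bool * bool)%type.

Definition positions (P : pred letter) (w : seq letter) : seq nat :=
  [seq i <- iota 0 (size w) | P (nth (false, false) w i)].

Local Notation openers := (positions fst).
Local Notation closers := (positions snd).

(** Only openers strictly before the closer count: a point that is both does not close the arc it
    opens. *)
Definition heights (w : seq letter) : seq nat :=
  [seq count (ltn^~ c) (openers w) | c <- closers w].

(* [minn e 2] is the number of open arcs that may be closed when [e] of them
   are open: all the pairs of patterns turn out to leave at most two choices. *)
Fixpoint weight (e f : nat) (w : seq letter) : nat :=
  match w with
  | [::] => e == f
  | (o, c) :: w' =>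
    if c then minn e 2 * weight (e.-1 + o) f w' else weight (e + o) f w'
  end.

Lemma positions_cons P l w :
  positions P (l :: w) = nseq (P l) 0 ++ map succn (positions P w).
Proof.
rewrite /positions /= (iotaDl 1 0) filter_map; case: (P l) => //=.
Qed.

Lemma heights_cons l w :
  heights (l :: w) = nseq l.2 0 ++ [seq l.1 + x | x <- heights w].
Proof.
rewrite /heights !positions_cons map_cat; congr (_ ++ _).
  by case: l.2 => //=; rewrite (eq_count (a2 := pred0)) // count_pred0.
rewrite -!map_comp; apply: eq_map => c /=.
rewrite count_cat count_map; congr (_ + _); by case: l.1.
Qed.

(** The part already read has [e] openers and [d] closers, so the current height is [e - d]. A
    closer met at height 0 makes both sides vanish. *)
Lemma weight_choices w e d : d <= e ->
  weight (e - d) 0 w = (e + size (openers w) == d + size (closers w))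
                     * choices d [seq e + x | x <- heights w].
Proof.
elim: w e d => [|[o c] w IHw] e d led /=.
  by rewrite muln1 !addn0 subn_eq0 eqn_leq led andbT.
rewrite heights_cons !positions_cons !size_cat !size_nseq !size_map map_cat.
rewrite -map_comp (eq_map (f := _ \o _) (fun x => addnA e o x)).
case: c => /=; last first.
  have -> : e - d + o = e + o - d by lia.
  by rewrite IHw -?addnA ?add0n //; lia.
rewrite addn0; case: (ltnP d e) => lt_de; last first.
  have -> : e - d = 0 by lia.
  by rewrite min0n mul0n muln0.
have -> : (e - d).-1 + o = e + o - d.+1 by lia.
rewrite IHw; last by lia.
by rewrite addnA [d + (1 + _)]addnA addn1 mulnCA.
Qed.

Lemma positions_sorted P w : sorted ltn (positions P w).
Proof. by apply: sorted_filter; [apply: ltn_trans|apply: iota_ltn_sorted]. Qed.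

Lemma mem_positions P w i : P (false, false) = false ->
  (i \in positions P w) = P (nth (false, false) w i).
Proof.
move=> P0; rewrite mem_filter mem_iota /=; case: ltnP => [|le]; rewrite ?andbT //.
by rewrite nth_default // P0.
Qed.

Lemma nth_lt_count (s : seq nat) i c : sorted ltn s -> i < size s ->
  (nth 0 s i < c) = (i < count (ltn^~ c) s).
Proof.
elim: s i => //= x s IHs i path_s.
have count0 : c <= x -> count (ltn^~ c) s = 0.
  move=> lecx; rewrite (eq_in_count (a2 := pred0)) ?count_pred0 // => y.
  by move/(allP (order_path_min ltn_trans path_s)) => /=; lia.
case: i => [_|i lti] /=; first by case: ltnP => // /count0->.
rewrite IHs ?(path_sorted path_s) //.
by case: (ltnP x c) => // /count0->; rewrite ltn0.
Qed.

Lemma heights_sorted w : sorted leq (heights w).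
Proof.
rewrite /heights; apply: (homo_sorted (e := ltn)); last exact: positions_sorted.
by move=> c d lt_cd; apply: sub_count => x /= /ltn_trans->.
Qed.

Lemma heights_bounded w : all (leq^~ (size (openers w))) (heights w).
Proof. by apply/allP=> _ /mapP[c _ ->]; apply: count_size. Qed.

(** * Arc systems *)

(** A relation on natural numbers, so that ends of arcs can be compared with positions in words
    without carrying bounds. *)
Definition linked m (A : arcs m) : rel nat :=
  fun i j => [exists p in A, (p.1 == i :> nat) && (p.2 == j :> nat)].

Lemma linkedP m (A : arcs m) (i j : 'I_m) : linked A i j = ((i, j) \in A).
Proof.
apply/existsP/idP => [[[i' j'] /and3P[ijA /eqP/val_inj<- /eqP/val_inj<-]] //|ijA].
by exists (i, j); rewrite ijA !eqxx.
Qed.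

Lemma linked_ord m (A : arcs m) i j : linked A i j ->
  exists2 p, p \in A & (i = p.1 /\ j = p.2).
Proof. by case/existsP=> p /and3P[pA /eqP<- /eqP<-]; exists p. Qed.

Lemma eq_linked m (A B : arcs m) : linked A =2 linked B -> A = B.
Proof. by move=> eqAB; apply/setP=> -[i j]; rewrite -!linkedP eqAB. Qed.

(** The common frame of matchings and partitions: each point opens at most one arc and closes at
    most one. *)
Definition arc_system m (A : arcs m) : bool :=
  [forall p in A, (p.1 < p.2) &&
     [forall q in A, (p.1 == q.1) || (p.2 == q.2) ==> (p == q)]].

Lemma arc_systemP m (A : arcs m) : reflect
  [/\ forall i j, linked A i j -> i < j,
      forall i j j', linked A i j -> linked A i j' -> j = j'
    & forall i i' j, linked A i j -> linked A i' j -> i = i']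
  (arc_system A).
Proof.
apply: (iffP 'forall_in_andP) => [sysA|[ltA funA injA] p pA].
  have eqA p q : p \in A -> q \in A -> (p.1 == q.1) || (p.2 == q.2) -> p = q.
    move=> pA qA; have [_ /forall_inP/(_ q qA)/implyP/[apply]/eqP] := sysA p pA.
    by [].
  split=> [i j|i j j'|i i' j].
  - by case/linked_ord=> p pA [-> ->]; have [] := sysA p pA.
  - case/linked_ord=> p pA [-> ->] /linked_ord[q qA [pq ->]].
    by rewrite (eqA p q pA qA) // -val_eqE /= pq eqxx.
  case/linked_ord=> p pA [-> ->] /linked_ord[q qA [-> pq]].
  by rewrite (eqA p q pA qA) // -!val_eqE /= pq eqxx orbT.
have linkA q : q \in A -> linked A q.1 q.2.
  by case: q => i j; rewrite linkedP.
split; first exact: ltA (linkA p pA).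
apply/forall_inP=> q qA; apply/implyP=> /orP[] /eqP pq; apply/eqP.
  have := linkA p pA; rewrite pq => /funA/(_ (linkA q qA))/val_inj eq2.
  by rewrite [p]surjective_pairing [q]surjective_pairing pq eq2.
have := linkA p pA; rewrite pq => /injA/(_ (linkA q qA))/val_inj eq1.
by rewrite [p]surjective_pairing [q]surjective_pairing pq eq1.
Qed.

Definition is_closer m (A : arcs m) (j : 'I_m) : bool :=
  [exists p in A, p.2 == j].

Definition type_word m (A : arcs m) : seq letter :=
  [seq (is_opener A i, is_closer A i) | i <- enum 'I_m].

Lemma size_type_word m (A : arcs m) : size (type_word A) = m.
Proof. by rewrite size_map size_enum_ord. Qed.

Lemma nth_type_word m (A : arcs m) (i : 'I_m) :
  nth (false, false) (type_word A) i = (is_opener A i, is_closer A i).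
Proof. by rewrite (nth_map i) ?size_enum_ord // nth_ord_enum. Qed.

Lemma openersP m (A : arcs m) i :
  reflect (exists j, linked A i j) (i \in openers (type_word A)).
Proof.
rewrite mem_positions //; apply: (iffP idP) => [|[j /linked_ord[p pA [-> _]]]].
  have [lt_im|le_mi] := ltnP i m; last by rewrite nth_default ?size_type_word.
  rewrite -[i]/(val (Ordinal lt_im)) nth_type_word /= => /existsP[[i' j] /= /andP[]].
  by move=> ijA /eqP/(congr1 val)/= <-; exists j; rewrite linkedP.
by rewrite nth_type_word /=; apply/existsP; exists p; rewrite pA /=.
Qed.

Lemma closersP m (A : arcs m) j :
  reflect (exists i, linked A i j) (j \in closers (type_word A)).
Proof.
rewrite mem_positions //; apply: (iffP idP) => [|[i /linked_ord[p pA [_ ->]]]].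
  have [lt_jm|le_mj] := ltnP j m; last by rewrite nth_default ?size_type_word.
  rewrite -[j]/(val (Ordinal lt_jm)) nth_type_word /= => /existsP[[i j'] /= /andP[]].
  by move=> ijA /eqP/(congr1 val)/= <-; exists i; rewrite linkedP.
by rewrite nth_type_word /=; apply/existsP; exists p; rewrite pA /=.
Qed.

Lemma positions_inj (w w' : seq letter) : size w = size w' ->
  openers w =i openers w' -> closers w =i closers w' -> w = w'.
Proof.
move=> eq_sz eqO eqC; apply: (@eq_from_nth _ (false, false)) => // i _.
have := eqO i; have := eqC i; rewrite !mem_positions //=.
by case: (nth _ w i) (nth _ w' i) => [? ?] [? ?] /= -> ->.
Qed.

(** * Occurrences of patterns of length 3 *)

Definition has_pattern (r : rel nat) (t : seq nat) : Prop :=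
  exists o0 o1 o2 c0 c1 c2,
    [/\ [/\ o0 < o1, o1 < o2, o2 < c0, c0 < c1 & c1 < c2]
      & forall a, a < 3 ->
          r (nth 0 [:: o0; o1; o2] a) (nth 0 [:: c0; c1; c2] (3 - nth 0 t a))].

Lemma size_one_line k (tau : 'S_k) : size (one_line tau) = k.
Proof. by rewrite size_map size_enum_ord. Qed.

Lemma nth_one_line k (tau : 'S_k) (i : 'I_k) : nth 0 (one_line tau) i = (tau i).+1.
Proof. by rewrite (nth_map i) ?size_enum_ord // nth_ord_enum. Qed.

Lemma containsP m (A : arcs m) (tau : 'S_3) :
  reflect (has_pattern (linked A) (one_line tau)) (contains A tau).
Proof.
apply: (iffP existsP) => [[f /andP[/forallP incf /forallP arcf]]|].
  have ltf (i j : 'I_(3 + 3)) : i < j -> f i < f j.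
    by have /forallP/(_ j)/implyP := incf i.
  pose g i : nat := f (inord i : 'I_(3 + 3)).
  have ltg i : i < 5 -> g i < g i.+1 by move=> ?; apply: ltf; rewrite !inordK //; lia.
  exists (g 0), (g 1), (g 2), (g 3), (g 4), (g 5); split; first by split; apply: ltg.
  move=> a lta; have := arcf (Ordinal lta); rewrite -linkedP.
  rewrite -[a]/(val (Ordinal lta)) nth_one_line; move: (Ordinal lta) => {lta}a.
  have -> : nth 0 [:: g 0; g 1; g 2] a = f (lshift 3 a).
    have <- : inord a = lshift 3 a :> 'I_(3 + 3).
      by apply: val_inj; rewrite /= inordK //; have := ltn_ord a; lia.
    by case: a => [[|[|[|?]]]].
  suff -> : nth 0 [:: g 3; g 4; g 5] (3 - (tau a).+1)
      = f (rev_ord (lshift 3 (tau a))) by [].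
  have <- : inord (3 + (2 - tau a)) = rev_ord (lshift 3 (tau a)) :> 'I_(3 + 3).
    by apply: val_inj; rewrite /= inordK //; have := ltn_ord (tau a); lia.
  rewrite subSS; by case: (tau a) => [[|[|[|?]]]].
case=> o0 [o1 [o2 [c0 [c1 [c2 [[lt1 lt2 lt3 lt4 lt5] link]]]]]].
(* As [tau] is onto, every closer of the occurrence ends some arc of [A], and so lies below [m]. *)
have ltc (a : 'I_3) : nth 0 [:: c0; c1; c2] a < m.
  pose b := (tau^-1)%g (rev_ord a).
  have := link b (ltn_ord b); rewrite nth_one_line permKV.
  have -> : 3 - (rev_ord a).+1 = a by have := ltn_ord a; rewrite /=; lia.
  by case/linked_ord=> p _ [_ ->].
have c2m : c2 < m := ltc ord_max.
pose s := [:: o0; o1; o2; c0; c1; c2].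
have lts i : i < 6 -> nth 0 s i < m.
  by case: i => [|[|[|[|[|[|]]]]]] //= _; lia.
exists [ffun i : 'I_(3 + 3) => Ordinal (lts i (ltn_ord i))].
apply/andP; split; apply/forallP=> a.
  apply/forallP=> b; apply/implyP; rewrite !ffunE /=.
  have : sorted ltn s by rewrite /= lt1 lt2 lt3 lt4 lt5.
  move/(sorted_ltn_nth ltn_trans 0)/(_ a b); rewrite !inE /= => incs.
  by apply: incs; apply: ltn_ord.
rewrite !ffunE -linkedP /=; have := link a (ltn_ord a); rewrite nth_one_line subSS.
have -> : nth 0 [:: o0; o1; o2] a = nth 0 s a by case: a => [[|[|[|?]]]].
suff -> : nth 0 [:: c0; c1; c2] (2 - tau a) = nth 0 s (3 + 3 - (tau a).+1) by [].
by case: (tau a) => [[|[|[|?]]]].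
Qed.

Lemma lt_nth_positions P w i j :
  i < size (positions P w) -> j < size (positions P w) ->
  (nth 0 (positions P w) i < nth 0 (positions P w) j) = (i < j).
Proof.
have srt := sorted_ltn_nth ltn_trans 0 (positions_sorted P w).
move=> lti ltj; case: (ltngtP i j) => [lt_ij|lt_ji|->]; last by rewrite ltnn.
  exact: srt.
by apply/negbTE; rewrite -leqNgt ltnW //; apply: srt.
Qed.

Lemma nth_positions_inj P w i j :
  i < size (positions P w) -> j < size (positions P w) ->
  nth 0 (positions P w) i = nth 0 (positions P w) j -> i = j.
Proof.
move=> lti ltj eq_ij; have := lt_nth_positions lti ltj.
have := lt_nth_positions ltj lti; rewrite eq_ij ltnn; lia.
Qed.

Lemma nth_heights w i l :
  i < size (openers w) -> l < size (closers w) ->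
  (nth 0 (openers w) i < nth 0 (closers w) l) = (i < nth 0 (heights w) l).
Proof.
move=> lti ltl; rewrite (nth_map 0) //; apply: nth_lt_count => //.
exact: positions_sorted.
Qed.

Lemma size_heights w : size (heights w) = size (closers w).
Proof. exact: size_map. Qed.

(* The sequence [s] codes the set of arcs [r] of type [w] by listing the ranks
   of the openers of the successive closers. *)
Definition codes w (s : seq nat) (r : rel nat) : Prop :=
  [/\ size s = size (closers w), all (ltn^~ (size (openers w))) s
    & forall i j, r i j <-> exists2 l, l < size s &
        i = nth 0 (openers w) (nth 0 s l) /\ j = nth 0 (closers w) l].

Lemma codes_inj w s s' r : codes w s r -> codes w s' r -> s = s'.
Proof.
case=> sz_s lt_s code_s [sz_s' lt_s' code_s'].
apply: (@eq_from_nth _ 0) => [|l ltl]; first by rewrite sz_s.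
have [l' ltl' [eqO eqC]] : exists2 l', l' < size s' &
    nth 0 (openers w) (nth 0 s l) = nth 0 (openers w) (nth 0 s' l') /\
    nth 0 (closers w) l = nth 0 (closers w) l'.
  by apply/code_s'/code_s; exists l.
have eq_l : l = l'.
  by apply: nth_positions_inj eqC; rewrite -?sz_s // sz_s -sz_s'.
apply: nth_positions_inj; first exact: (all_nthP 0 lt_s).
  by apply: (all_nthP 0 lt_s'); rewrite eq_l.
by rewrite {2}eq_l.
Qed.

(** In an occurrence the last opener precedes the first closer, so the three arcs are all open at
    the closer [i]; conversely, open arcs closed in the order described by [t] form an
    occurrence. *)
Lemma has_pattern_codes w s r t :
  codes w s r -> (forall l, l < size s -> nth 0 s l < nth 0 (heights w) l) ->
  t \in permutations [:: 1; 2; 3] ->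
  has_pattern r t <->
  exists i j l, [/\ i < j < l, l < size s,
    nth 0 s j < nth 0 (heights w) i, nth 0 s l < nth 0 (heights w) i
    & closes_as t (nth 0 s i) (nth 0 s j) (nth 0 s l)].
Proof.
case=> sz_s /(all_nthP 0) lt_s code_s lt_h t_perm.
have ltO l : l < size s -> nth 0 s l < size (openers w) := lt_s l.
have ltC l : l < size s -> l < size (closers w) by rewrite sz_s.
split; last first.
  case=> i [j [l [/andP[lt_ij lt_jl] ltl ltj_i ltl_i]]].
  have ltj := ltn_trans lt_jl ltl; have lti := ltn_trans lt_ij ltj.
  have link k : k < size s ->
      r (nth 0 (openers w) (nth 0 s k)) (nth 0 (closers w) k).
    by move=> ltk; apply/code_s; exists k.
  pose o k := nth 0 (openers w)
    (nth 0 [:: nth 0 s i; nth 0 s j; nth 0 s l] (3 - nth 0 t k)).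
  move=> closes_t.
  exists (o 0), (o 1), (o 2), (nth 0 (closers w) i), (nth 0 (closers w) j).
  exists (nth 0 (closers w) l); split; last first.
    move=> a lta; have -> : nth 0 [:: o 0; o 1; o 2] a = o a.
      by case: a lta => [|[|[|]]].
    have : 3 - nth 0 t a < 3.
      by move: t_perm; rewrite /= !inE; do ![case/orP|move/eqP->];
        case: a lta => [|[|[|]]].
    by rewrite /o; case: (3 - nth 0 t a) => [|[|[|]]] //= _; apply: link.
  move: t_perm closes_t; rewrite /= !inE /closes_as /o.
  have ltsi := lt_h i lti.
  do ![case/orP|move/eqP->] => /= /and3P[lt1 lt2 _];
    by rewrite !lt_nth_positions ?nth_heights ?ltO ?ltC // lt1 lt2 lt_ij lt_jl.
case=> o0 [o1 [o2 [c0 [c1 [c2 [[lt1 lt2 lt3 lt4 lt5] link]]]]]].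
(* [x], [y], [z] are the indices of the closers of the three arcs, taken by increasing opener; each
   of the six patterns sorts them in its own way. *)
have [x ltx [eq_o0 eq_x]] := (code_s _ _).1 (link 0 isT).
have [y lty [eq_o1 eq_y]] := (code_s _ _).1 (link 1 isT).
have [z ltz [eq_o2 eq_z]] := (code_s _ _).1 (link 2 isT).
move: eq_o0 eq_o1 eq_o2 => /= eq_o0 eq_o1 eq_o2; subst o0 o1 o2.
rewrite lt_nth_positions ?ltO // in lt1; rewrite lt_nth_positions ?ltO // in lt2.
move: t_perm lt3 lt4 lt5 eq_x eq_y eq_z; rewrite /= !inE {link}.
do ![case/orP|move/eqP->] => /= lt3 lt4 lt5 eq_x eq_y eq_z; subst c0 c1 c2.
all: rewrite nth_heights ?ltC ?ltO // in lt3.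
all: rewrite lt_nth_positions ?ltC // in lt4.
all: rewrite lt_nth_positions ?ltC // in lt5.
all: rewrite /closes_as /=.
- exists z, x, y; split; lia.
- exists z, y, x; split; lia.
- exists x, z, y; split; lia.
- exists y, z, x; split; lia.
- exists y, x, z; split; lia.
- exists x, y, z; split; lia.
Qed.

Lemma encode_subproof m (A : arcs m) c : arc_system A ->
  c \in closers (type_word A) ->
  let i := find (linked A ^~ c) (openers (type_word A)) in
  i < size (openers (type_word A)) /\ linked A (nth 0 (openers (type_word A)) i) c.
Proof.
move=> sysA /closersP[o oc] i.
have has_o : has (linked A ^~ c) (openers (type_word A)).
  by apply/hasP; exists o => //; apply/openersP; exists c.
by split; [rewrite -has_find|apply: (nth_find 0 has_o)].
Qed.

Definition encode m (A : arcs m) : seq nat :=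
  [seq find (linked A ^~ c) (openers (type_word A)) | c <- closers (type_word A)].

Lemma encode_codes m (A : arcs m) :
  arc_system A -> codes (type_word A) (encode A) (linked A).
Proof.
move=> sysA; have [_ _ injA] := arc_systemP _ sysA.
split; first exact: size_map.
  apply/allP=> _ /mapP[c /(encode_subproof sysA)[lt_c _] ->]; exact: lt_c.
move=> i j; split=> [ij|[l]].
  have jC : j \in closers (type_word A) by apply/closersP; exists i.
  exists (index j (closers (type_word A))); first by rewrite size_map index_mem.
  rewrite (nth_map 0) ?index_mem // nth_index //; split=> //.
  by have [_ /(injA _ _ _ ij)] := encode_subproof sysA jC.
rewrite size_map => ltl [-> ->]; rewrite (nth_map 0) //.
by have [] := encode_subproof sysA (mem_nth 0 ltl).
Qed.

Lemma codes_heights w s r : codes w s r -> (forall i j, r i j -> i < j) ->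
  forall l, l < size s -> nth 0 s l < nth 0 (heights w) l.
Proof.
case=> sz_s /(all_nthP 0) lt_s code_s ltr l ltl.
rewrite -nth_heights -?sz_s //; last exact: lt_s.
by apply/ltr/code_s; exists l.
Qed.

Lemma codes_uniq w s r : codes w s r ->
  (forall i j j', r i j -> r i j' -> j = j') -> uniq s.
Proof.
case=> sz_s lt_s code_s funr; apply/(uniqP 0) => k l; rewrite !inE => ltk ltl eq_kl.
apply: (@nth_positions_inj snd w); rewrite -?sz_s //.
apply: (funr (nth 0 (openers w) (nth 0 s k))); apply/code_s; first by exists k.
by exists l => //; rewrite eq_kl.
Qed.

Definition decode m (w : seq letter) (s : seq nat) : arcs m :=
  [set p : 'I_m * 'I_m | [exists l : 'I_(size s),
     (p.1 == nth 0 (openers w) (nth 0 s l) :> nat) &&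
     (p.2 == nth 0 (closers w) l :> nat)]].

Lemma positions_bounded P w i : i \in positions P w -> i < size w.
Proof. by rewrite mem_filter mem_iota => /and3P[]. Qed.

Lemma decode_codes m w s : size w = m -> size s = size (closers w) ->
  all (ltn^~ (size (openers w))) s -> codes w s (linked (decode m w s)).
Proof.
move=> sz_w sz_s lt_s; split=> // i j; split.
  case/linked_ord=> p; rewrite inE => /existsP[l /andP[/eqP eq1 /eqP eq2]] [-> ->].
  by exists l.
case=> l ltl [-> ->].
have lto : nth 0 (openers w) (nth 0 s l) < m.
  by rewrite -sz_w; apply/positions_bounded/mem_nth; apply: (all_nthP 0 lt_s).
have ltc : nth 0 (closers w) l < m.
  by rewrite -sz_w; apply/positions_bounded/mem_nth; rewrite -sz_s.
rewrite (linkedP _ (Ordinal lto) (Ordinal ltc)) inE; apply/existsP.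
by exists (Ordinal ltl); rewrite !eqxx.
Qed.

Lemma positions_uniq P w : uniq (positions P w).
Proof. by rewrite filter_uniq ?iota_uniq. Qed.

Lemma enum_linked m (A : arcs m) p : p \in enum A -> linked A p.1 p.2.
Proof. by rewrite mem_enum; case: p => i j; rewrite linkedP. Qed.

Lemma size_openers m (A : arcs m) :
  arc_system A -> size (openers (type_word A)) = #|A|.
Proof.
case/arc_systemP=> _ funA _; rewrite cardE -(size_map (fun p => val p.1)).
apply/perm_size/uniq_perm => [||i]; rewrite ?positions_uniq //.
  rewrite map_inj_in_uniq ?enum_uniq // => -[i j] [i' j'].
  move=> /enum_linked/= ij /enum_linked/= ij' /val_inj eq_i.
  by rewrite -eq_i in ij' *; rewrite (val_inj (funA _ _ _ ij ij')).
apply/openersP/mapP => [[j /linked_ord[p pA [-> _]]]|[p /enum_linked pA ->]].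
  by exists p; rewrite ?mem_enum.
by exists (val p.2).
Qed.

Lemma size_closers m (A : arcs m) :
  arc_system A -> size (closers (type_word A)) = #|A|.
Proof.
case/arc_systemP=> _ _ injA; rewrite cardE -(size_map (fun p => val p.2)).
apply/perm_size/uniq_perm => [||j]; rewrite ?positions_uniq //.
  rewrite map_inj_in_uniq ?enum_uniq // => -[i j] [i' j'].
  move=> /enum_linked/= ij /enum_linked/= ij' /val_inj eq_j.
  by rewrite -eq_j in ij' *; rewrite (val_inj (injA _ _ _ ij ij')).
apply/closersP/mapP => [[i /linked_ord[p pA [_ ->]]]|[p /enum_linked pA ->]].
  by exists p; rewrite ?mem_enum.
by exists (val p.1).
Qed.

(** * Diagrams with a given type word *)

Definition diagrams k m (w : seq letter) (sigma tau : 'S_k) : {set arcs m} :=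
  [set A | [&& arc_system A, type_word A == w, avoids A sigma & avoids A tau]].

Lemma direct_pairs_permutations s t : (s, t) \in direct_pairs ->
  (s \in permutations [:: 1; 2; 3]) && (t \in permutations [:: 1; 2; 3]).
Proof.
by rewrite /direct_pairs !inE; do ![case/orP|move/eqP=> [-> ->]].
Qed.

(** For the code of an arc system every condition of [validP] except the last is automatic, and the
    last one is the absence of both patterns. *)
Lemma avoids_valid m (A : arcs m) w s (sigma tau : 'S_3) :
  (one_line sigma, one_line tau) \in direct_pairs ->
  arc_system A -> codes w s (linked A) ->
  avoids A sigma && avoids A tau
    = valid (closes_badly (one_line sigma) (one_line tau)) (heights w) s.
Proof.
move=> st sysA code_s; have [ltA funA injA] := arc_systemP _ sysA.
have [sigmaP tauP] := andP (direct_pairs_permutations st).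
have lt_h := codes_heights code_s ltA.
have patP := has_pattern_codes code_s lt_h.
rewrite /avoids -negb_or; apply/idP/validP => [avA|[_ _ _ good_s]].
  split=> //; first by rewrite size_heights; case: code_s.
    exact: codes_uniq code_s funA.
  move=> i j l ltij ltl lt1 lt2; apply: contra avA => /orP[] bad_s; apply/orP.
    by left; apply/containsP/patP => //; exists i, j, l.
  by right; apply/containsP/patP => //; exists i, j, l.
apply/negP=> /orP[] /containsP/patP[] // i [j [l [ltij ltl lt1 lt2 bad_s]]].
  by have /negP[] := good_s _ _ _ ltij ltl lt1 lt2; rewrite /closes_badly bad_s.
have /negP[] := good_s _ _ _ ltij ltl lt1 lt2.
by rewrite /closes_badly bad_s orbT.
Qed.

(** [encode] is a bijection from these diagrams onto the valid sequences for [heights w], with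
    [decode] as inverse; [valid_enum] counts the latter. If openers and closers differ in number,
    both sides are zero. *)
Lemma card_diagrams_direct m w (sigma tau : 'S_3) :
  (one_line sigma, one_line tau) \in direct_pairs -> size w = m ->
  #|diagrams m w sigma tau| = weight 0 0 w.
Proof.
move=> st sz_w; have -> := @weight_choices w 0 0 (leqnn 0); rewrite !add0n map_id.
have [eq_sz|neq_sz] := eqVneq (size (openers w)) (size (closers w)); last first.
  rewrite mul0n; apply: eq_card0 => A; rewrite inE.
  apply: contra_neqF neq_sz => /and3P[sysA /eqP <- _].
  by rewrite size_openers ?size_closers.
have hb := heights_bounded w; rewrite eq_sz -size_heights in hb.
have [l [uniq_l mem_l sz_l]] := valid_enum (closes_badly_bump st)
  (two_insertions st) (heights_sorted w) hb.
rewrite mul1n -sz_l cardE -(size_map (@encode m)).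
apply/perm_size/uniq_perm => // [|s].
  rewrite map_inj_in_uniq ?enum_uniq // => A B; rewrite !mem_enum !inE.
  case/and3P=> sysA /eqP typA _ /and3P[sysB /eqP typB _] eq_code.
  apply: eq_linked => i j; apply/idP/idP.
    have [_ _ codeA] := encode_codes sysA; have [_ _ codeB] := encode_codes sysB.
    by move/codeA=> ij; apply/codeB; rewrite typB -typA -eq_code.
  have [_ _ codeA] := encode_codes sysA; have [_ _ codeB] := encode_codes sysB.
  by move/codeB=> ij; apply/codeA; rewrite typA -typB eq_code.
rewrite mem_l; apply/mapP/idP => [[A]|vs].
  rewrite mem_enum inE => /and3P[sysA /eqP<- avA] ->.
  by rewrite -(avoids_valid st sysA (encode_codes sysA)).
have [sz_s uniq_s lt_s _] := validP _ _ _ vs; rewrite size_heights in sz_s.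
have lt_s' : all (ltn^~ (size (openers w))) s.
  by rewrite eq_sz -size_heights; apply: valid_bounded hb vs.
have code_s := decode_codes sz_w sz_s lt_s'; have [_ _ codeP] := code_s.
have sysA : arc_system (decode m w s).
  apply/arc_systemP; split=> [i j|i j j'|i i' j].
  - case/codeP=> k ltk [-> ->]; rewrite nth_heights -?sz_s ?lt_s //.
    exact: (all_nthP 0 lt_s').
  - case/codeP=> k ltk [-> ->] /codeP[k' ltk' [eq_o ->]].
    move/nth_positions_inj: eq_o => /(_ (all_nthP 0 lt_s' _ ltk)).
    by move=> /(_ (all_nthP 0 lt_s' _ ltk'))/eqP; rewrite nth_uniq // => /eqP->.
  case/codeP=> k ltk [-> ->] /codeP[k' ltk' [-> eq_c]].
  by move/nth_positions_inj: eq_c => ->; rewrite -?sz_s.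
have typA : type_word (decode m w s) = w.
  apply: positions_inj; first by rewrite size_type_word.
    move=> i; apply/openersP/idP => [[j /codeP[k ltk [-> _]]]|iO].
      by apply/mem_nth/(all_nthP 0 lt_s').
    (* A valid sequence is a permutation of all ranks, so every opener of [w] really starts an
       arc. *)
    have := perm_mem (valid_perm hb vs) (index i (openers w)).
    rewrite mem_iota size_heights -eq_sz index_mem iO => /(nthP 0)[k ltk eq_k].
    exists (nth 0 (closers w) k); apply/codeP; exists k => //.
    by rewrite eq_k nth_index.
  move=> j; apply/closersP/idP => [[i /codeP[k ltk [_ ->]]]|jC].
    by rewrite mem_nth -?sz_s.
  exists (nth 0 (openers w) (nth 0 s (index j (closers w)))).
  apply/codeP; exists (index j (closers w)); first by rewrite sz_s index_mem.
  by rewrite nth_index.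
exists (decode m w s).
  by rewrite mem_enum inE sysA typA eqxx (avoids_valid st sysA code_s).
by apply: codes_inj code_s _; rewrite -{1}typA; apply: encode_codes.
Qed.

(** * Reversal of diagrams *)

Definition rev_word (w : seq letter) : seq letter := rev [seq (l.2, l.1) | l <- w].

(** A path that ends at height [f] was at height [f - o + c] before its last letter. *)
Lemma weight_rcons e f w o c : weight e f (rcons w (o, c)) =
  (o <= f) * (if c then minn (f - o).+1 2 else 1) * weight e (f - o + c) w.
Proof.
elim: w e => [|[o' c'] w IHw] e /=; last first.
  by case: c' => //; rewrite IHw; ring.
case: o c => [] [] /=; case: eqP => /=; case: eqP => /=; lia.
Qed.

(* Weighting the openers instead of the closers multiplies the weight of a path
   by [2 ^ f.-1 / 2 ^ e.-1]. *)
Lemma weight_rev e f w :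
  weight e f w * 2 ^ f.-1 = weight f e (rev_word w) * 2 ^ e.-1.
Proof.
elim: w e => [|[o c] w IHw] e; first by rewrite /= eq_sym; case: eqP => [->|].
rewrite /rev_word map_cons rev_cons weight_rcons -/(rev_word w).
(* One letter leads from height [e] to height [x]; [y] is its weight read forwards and [b] its
   weight read backwards. *)
have step x y a b : a * 2 ^ f.-1 = weight f x (rev_word w) * 2 ^ x.-1 ->
    y * 2 ^ x.-1 = b * 2 ^ e.-1 ->
    y * a * 2 ^ f.-1 = b * weight f x (rev_word w) * 2 ^ e.-1.
  by move=> eq1 eq2; rewrite -mulnA eq1 mulnCA eq2; ring.
case: c => /=; last first.
  rewrite subn0 mul1n -[weight _ _ w]mul1n; apply: step (IHw _) _.
  by case: o; case: e => [|[|e]]; rewrite ?addn0 ?addn1 //= ?expnS; lia.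
case: e step => [|e] step; first by rewrite min0n !mul0n.
rewrite subSS subn0 mul1n; apply: step (IHw _) _.
by case: o; case: e => [|[|e]]; rewrite ?addn0 ?addn1 //= ?expnS; lia.
Qed.

Lemma weight_rev_word w : weight 0 0 (rev_word w) = weight 0 0 w.
Proof. by have := weight_rev 0 0 w; rewrite !muln1. Qed.

Definition rev_arcs m (A : arcs m) : arcs m :=
  [set (rev_ord p.2, rev_ord p.1) | p in A].

Lemma mem_rev_arcs m (A : arcs m) i j :
  ((i, j) \in rev_arcs A) = ((rev_ord j, rev_ord i) \in A).
Proof.
apply/imsetP/idP => [[[i' j'] ijA [-> ->]]|ijA]; first by rewrite /= !rev_ordK.
by exists (rev_ord j, rev_ord i); rewrite //= !rev_ordK.
Qed.

Lemma rev_arcsK m : involutive (@rev_arcs m).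
Proof. by move=> A; apply/setP=> -[i j]; rewrite !mem_rev_arcs !rev_ordK. Qed.

Lemma linked_rev m (A : arcs m) i j : linked (rev_arcs A) i j ->
  [/\ i < m, j < m & linked A (m - j.+1) (m - i.+1)].
Proof.
case/linked_ord=> -[i' j']; rewrite mem_rev_arcs => ijA [-> ->].
by rewrite -linkedP in ijA; split.
Qed.

Lemma arc_system_rev m (A : arcs m) : arc_system A -> arc_system (rev_arcs A).
Proof.
case/arc_systemP=> ltA funA injA; apply/arc_systemP; split=> [i j|i j j'|i i' j].
- by case/linked_rev=> ? ? /ltA; lia.
- by case/linked_rev=> ? ? ij /linked_rev[? ? /injA/(_ ij)]; lia.
- by case/linked_rev=> ? ? ij /linked_rev[? ? /funA/(_ ij)]; lia.
Qed.

Lemma is_opener_rev m (A : arcs m) i : is_opener (rev_arcs A) i = is_closer A (rev_ord i).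
Proof.
apply/existsP/existsP => -[[j k] /= /andP[jkA /eqP eq_i]].
  by exists (rev_ord k, rev_ord j); rewrite -mem_rev_arcs jkA eq_i /=.
by exists (rev_ord k, rev_ord j); rewrite mem_rev_arcs !rev_ordK jkA eq_i rev_ordK /=.
Qed.

Lemma is_closer_rev m (A : arcs m) i : is_closer (rev_arcs A) i = is_opener A (rev_ord i).
Proof. by rewrite -{2}[A]rev_arcsK is_opener_rev rev_ordK. Qed.

Lemma type_word_rev m (A : arcs m) : type_word (rev_arcs A) = rev_word (type_word A).
Proof.
apply: (@eq_from_nth _ (false, false)) => [|i].
  by rewrite size_rev size_map !size_type_word.
rewrite size_type_word => lti; rewrite -[i]/(val (Ordinal lti)) nth_type_word.
rewrite nth_rev size_map size_type_word //.
rewrite (nth_map (false, false)) ?size_type_word; last by rewrite /=; lia.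
rewrite -[m - _]/(val (rev_ord (Ordinal lti))) nth_type_word.
by rewrite is_opener_rev is_closer_rev.
Qed.

(** Reflecting the points exchanges openers and closers and reverses their order, which turns a
    pattern into its inverse. *)
Lemma contains_rev m (A : arcs m) (tau : 'S_3) :
  contains (rev_arcs A) tau -> contains A tau^-1.
Proof.
case/containsP=> o0 [o1 [o2 [c0 [c1 [c2 [[lt1 lt2 lt3 lt4 lt5] link]]]]]].
have lt_m a : a < 3 -> nth 0 [:: o0; o1; o2] a < m /\ nth 0 [:: c0; c1; c2] a < m.
  move=> lta; split; first by have [] := linked_rev (link a lta).
  pose b := (tau^-1)%g (rev_ord (Ordinal lta)).
  have := link b (ltn_ord b); rewrite nth_one_line permKV.
  have -> : 3 - (rev_ord (Ordinal lta)).+1 = a by rewrite /=; lia.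
  by case/linked_rev.
have [ltc0 ltc1 ltc2] := And3 (lt_m 0 isT).2 (lt_m 1 isT).2 (lt_m 2 isT).2.
have [lto0 lto1 lto2] := And3 (lt_m 0 isT).1 (lt_m 1 isT).1 (lt_m 2 isT).1.
move: ltc0 ltc1 ltc2 lto0 lto1 lto2 => /= ltc0 ltc1 ltc2 lto0 lto1 lto2.
pose r i := m - i.+1.
apply/containsP; exists (r c2), (r c1), (r c0), (r o2), (r o1), (r o0).
split=> [|a lta]; first by rewrite /r; split; lia.
(* The [a]-th opener of the reflected occurrence comes from the closer of index [2 - a], which
   belongs to the arc with opener index [b]. *)
pose b := (tau^-1)%g (Ordinal lta).
have := link b (ltn_ord b); rewrite nth_one_line permKV /= => /linked_rev[_ _].
rewrite -[a in nth 0 (one_line _) a]/(val (Ordinal lta)) nth_one_line -/b.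
have -> : m - (nth 0 [:: c0; c1; c2] (3 - a.+1)).+1 = nth 0 [:: r c2; r c1; r c0] a.
  by case: a lta {b} => [|[|[|]]].
suff -> : m - (nth 0 [:: o0; o1; o2] b).+1 = nth 0 [:: r o2; r o1; r o0] (3 - b.+1) by [].
by case: b => [[|[|[|]]]].
Qed.

Lemma card_diagrams_rev m w (sigma tau : 'S_3) :
  #|diagrams m w sigma tau| = #|diagrams m (rev_word w) sigma^-1 tau^-1|.
Proof.
have rev_wordK : involutive rev_word.
  move=> v; rewrite /rev_word map_rev revK -map_comp map_id_in // => -[].
  by [].
have sub (s t : 'S_3) v A : A \in diagrams m v s t ->
    rev_arcs A \in diagrams m (rev_word v) s^-1 t^-1.
  rewrite !inE => /and4P[sysA /eqP<- avs avt].
  rewrite arc_system_rev // type_word_rev eqxx /avoids /=.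
  by apply/andP; split; [apply: contra avs | apply: contra avt];
    move/contains_rev; rewrite invgK.
apply/eqP; rewrite eqn_leq; apply/andP; split.
  rewrite -(card_imset _ (inv_inj (@rev_arcsK m))) subset_leq_card //.
  by apply/subsetP=> B /imsetP[A /sub revA ->].
rewrite -(card_imset _ (inv_inj (@rev_arcsK m))) subset_leq_card //.
by apply/subsetP=> B /imsetP[A /sub revA ->]; rewrite rev_wordK !invgK in revA.
Qed.

Lemma one_lineV k (tau : 'S_k) :
  one_line tau^-1 = [seq (index i.+1 (one_line tau)).+1 | i <- iota 0 k].
Proof.
apply: (@eq_from_nth _ 0) => [|i]; first by rewrite size_map size_iota size_one_line.
rewrite size_one_line => lti; rewrite -[i]/(val (Ordinal lti)).
move: (Ordinal lti) => {lti}i.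
rewrite nth_one_line (nth_map 0) ?size_iota ?ltn_ord // nth_iota ?ltn_ord // add0n.
have -> : i.+1 = nth 0 (one_line tau) (tau^-1%g i) by rewrite nth_one_line permKV.
rewrite index_uniq ?size_one_line // map_inj_uniq ?enum_uniq //.
by move=> x y [/val_inj/perm_inj].
Qed.

Lemma card_diagrams m w (sigma tau : 'S_3) :
  (one_line sigma, one_line tau) \in listed_pairs -> size w = m ->
  #|diagrams m w sigma tau| = weight 0 0 w.
Proof.
move=> st sz_w.
pose inv (s : seq nat) := [seq (index i.+1 s).+1 | i <- iota 0 3].
(* A finite check: each listed pair is direct, or its entrywise inverse is direct with the same
   order of the two patterns. *)
have /allP/(_ _ st)/orP[] : all (fun p => (p \in direct_pairs)
    || ((inv p.1, inv p.2) \in direct_pairs)) listed_pairs by [].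
  by move=> st'; apply: card_diagrams_direct.
rewrite /inv -!one_lineV card_diagrams_rev -weight_rev_word => st'.
by apply: card_diagrams_direct; rewrite // size_rev size_map.
Qed.

(** * Perfect matchings *)

Lemma size_positions P w : size (positions P w) = count P w.
Proof.
elim: w => //= l w IHw; rewrite positions_cons size_cat size_nseq size_map IHw //.
Qed.

Lemma matching_wordE n (M : arcs (n + n)) : matching_word M = map fst (type_word M).
Proof.
by rewrite -map_comp; apply: eq_map => i /=; case: (is_opener M i).
Qed.

Lemma disjoint_arcsP m (p q : 'I_m * 'I_m) : reflect
  [/\ p.1 != q.1, p.1 != q.2, p.2 != q.1 & p.2 != q.2] (disjoint_arcs p q).
Proof.
rewrite /disjoint_arcs disjoints_subset !(subUset, sub1set) !inE !negb_or -andbA.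
exact: and4P.
Qed.

(** Openers and closers number [#|M|] each. By inclusion and exclusion, disjoint pairs with
    [#|M| = n] amount to every one of the [n + n] points being exactly one of the two. *)
Lemma perfect_matchingE n (M : arcs (n + n)) :
  perfect_matching M = arc_system M && all (fun l => l.1 != l.2) (type_word M).
Proof.
have counts : arc_system M -> count fst (type_word M) + count snd (type_word M)
    = #|M| + #|M|.
  by move=> sysM; rewrite -!size_positions size_openers ?size_closers.
have cntU := count_predUI fst snd (type_word M).
apply/and3P/andP => [[/eqP cardM /forall_inP ltM /forall_inP disjM]|[sysM xorM]].
  have disj p q : p \in M -> q \in M -> p != q -> disjoint_arcs p q.
    by move=> /disjM/forall_inP/(_ q)/[apply]/implyP.
  have sysM : arc_system M.
    apply/forall_inP=> p pM; rewrite ltM //=; apply/forall_inP=> q qM.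
    apply: contraTT isT => /=; rewrite negb_imply => /andP[+ neq_pq].
    by have /disjoint_arcsP[/negPf-> _ _ /negPf->] := disj p q pM qM neq_pq.
  split=> //; have noI : count (predI fst snd) (type_word M) = 0.
    apply/eqP; rewrite -leqn0 leqNgt -has_count; apply/hasPn=> _ /mapP[i _ ->] /=.
    apply/negP=> /andP[/exists_inP[p pM /eqP p1] /exists_inP[q qM /eqP q2]].
    have neq_pq : p != q.
      by apply: contraTneq (ltM p pM) => eq_pq; rewrite p1 eq_pq q2 ltnn.
    by have /disjoint_arcsP[_] := disj p q pM qM neq_pq; rewrite p1 q2 eqxx.
  have : count (predU fst snd) (type_word M) = size (type_word M).
    by have := counts sysM; rewrite -cntU noI size_type_word cardM addn0.
  move/eqP; rewrite -all_count => allU; apply/allP=> l l_in.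
  have := allP allU l l_in; have /hasPn/(_ l l_in) : ~~ has (predI fst snd) (type_word M).
    by rewrite has_count noI.
  by case: l {l_in} => [[] []].
have noI : count (predI fst snd) (type_word M) = 0.
  apply/eqP; rewrite -leqn0 leqNgt -has_count; apply/hasPn=> l /(allP xorM).
  by case: l => [[] []].
have [ltM funM injM] := arc_systemP _ sysM.
have linkM p : p \in M -> linked M p.1 p.2.
  by move=> pM; apply: enum_linked; rewrite mem_enum.
have xor i j k : linked M i j -> linked M k i -> False.
  move=> ij ki; have iO : i \in openers (type_word M) by apply/openersP; exists j.
  have iC : i \in closers (type_word M) by apply/closersP; exists k.
  have lti := positions_bounded iO; rewrite !mem_positions // in iO iC.
  by have := allP xorM _ (mem_nth (false, false) lti); rewrite iO iC.
split.
- have : count (predU fst snd) (type_word M) = size (type_word M).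
    apply/eqP; rewrite -all_count; apply: sub_all xorM => l.
    by case: l => [[] []].
  rewrite size_type_word; move: cntU; rewrite noI addn0 counts // => ->; lia.
- by apply/forall_inP=> p /linkM; apply: ltM.
apply/forall_inP=> p pM; apply/forall_inP=> q qM; apply/implyP=> neq_pq.
have := linkM p pM; have := linkM q qM => linkq linkp.
have sys := forall_inP (andP (forall_inP sysM p pM)).2 q qM.
rewrite (negPf neq_pq) implybF negb_or in sys; have [neq1 neq2] := andP sys.
apply/disjoint_arcsP; split=> //; apply/eqP => eq_pq.
  by rewrite eq_pq in linkp; apply: xor linkp linkq.
by rewrite eq_pq in linkp; apply: xor linkq linkp.
Qed.

Definition matching_letter (b : step) : letter := (b, ~~ b).

(** In a perfect matching a point that is not an opener is a closer, so the word of openers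
    determines the type word. *)
Lemma card_matchings_word n (w : seq step) (sigma tau : 'S_3) :
  (one_line sigma, one_line tau) \in listed_pairs -> size w = n + n ->
  #|[set M in matchings n sigma tau | matching_word M == w]|
    = weight 0 0 (map matching_letter w).
Proof.
move=> st sz_w; rewrite -(card_diagrams st (m := n + n)) ?size_map //.
apply: eq_card => M; rewrite !inE perfect_matchingE matching_wordE.
case: (arc_system M) => //=; rewrite andbC andbA [_ && all _ _]andbC -!andbA.
rewrite andbA; congr (_ && _); apply/andP/eqP => [[xorM /eqP<-]|->].
  rewrite -map_comp map_id_in // => l /(allP xorM).
  by case: l => [[] []].
split; first by apply/allP=> _ /mapP[b _ ->]; case: b.
by rewrite -map_comp map_id_in.
Qed.

(** Generalized to a path whose first part, already read, has [a] east and [b] south steps; its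
    height above the diagonal is [a - b]. *)
Lemma weight_dyck n w a b : b <= a ->
  a + count_mem east w = n -> b + count_mem south w = n ->
  (forall k, k <= size w ->
     n <= a + count_mem east (take k w) + (n - (b + count_mem south (take k w)))) ->
  let r := count (fun k => (nth east w k == south) &&
    (a + count_mem east (take k.+1 w)
      + (n - (b + count_mem south (take k.+1 w))) == n)) (iota 0 (size w)) in
  r <= count_mem south w /\
  weight (a - b) 0 (map matching_letter w) = 2 ^ (count_mem south w - r).
Proof.
elim: w a b => [|s w IHw] a b leba eqE eqS dyck /=.
  by rewrite /= !addn0 in eqE eqS; rewrite eqE eqS subnn.
rewrite (iotaDl 1 0) count_map.
have dyck1 := dyck 1 isT; rewrite /= take0 /= !addn0 in dyck1.
case: s => /= in eqE eqS dyck dyck1 *.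
  rewrite addnA addn1 in eqE; rewrite add0n in eqS.
  have {IHw} [|//|//|k lek|ler wgt] := IHw a.+1 b; first lia.
    by have := dyck k.+1 lek; rewrite /= addnA addn1.
  have -> : a - b + 1 = a.+1 - b by lia.
  have cntE : count (preim (addn 1) (fun k => (nth east (true :: w) k == south) &&
      (a + count_mem east (take k.+1 (true :: w)) +
        (n - (b + count_mem south (take k.+1 (true :: w)))) == n)))
      (iota 0 (size w)) = count (fun k => (nth east w k == south) &&
      (a.+1 + count_mem east (take k.+1 w) +
        (n - (b + count_mem south (take k.+1 w))) == n)) (iota 0 (size w)).
    by apply: eq_count => k; rewrite /= addnA addn1.
  by move: ler wgt; rewrite -cntE.
rewrite addnA addn1 in eqS; rewrite add0n in eqE.
have {IHw} [|//|//|k lek|ler wgt] := IHw a b.+1; first lia.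
  by have := dyck k.+1 lek; rewrite /= add0n addnA addn1.
have -> : (a - b).-1 + 0 = a - b.+1 by lia.
have cntE : count (preim (addn 1) (fun k => (nth east (false :: w) k == south) &&
    (a + count_mem east (take k.+1 (false :: w)) +
      (n - (b + count_mem south (take k.+1 (false :: w)))) == n)))
    (iota 0 (size w)) = count (fun k => (nth east w k == south) &&
    (a + count_mem east (take k.+1 w) +
      (n - (b.+1 + count_mem south (take k.+1 w))) == n)) (iota 0 (size w)).
  by apply: eq_count => k; rewrite /= add1n add0n [b + _]addnA addn1.
move: ler wgt; rewrite -cntE take0 /= !addn0.
set r := count _ _ => ler ->; rewrite addn1.
(* A south step is a return exactly when it starts at height 1; it then has weight 1, and weight 2
   otherwise. *)
have -> : (a + (n - b.+1) == n) = (a == b.+1) by lia.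
split; first lia.
case: eqP => [->|neq] /=; last first.
  rewrite add0n (_ : minn _ _ = 2); last by lia.
  by rewrite -expnS; congr (2 ^ _); lia.
rewrite (_ : minn _ _ = 1) ?mul1n; last by lia.
by congr (2 ^ _); lia.
Qed.

Lemma weight_dyck_path n w : dyck_path n w ->
  weight 0 0 (map matching_letter w) = 2 ^ (n - returns n w).
Proof.
case/and3P=> /eqP eqE /eqP eqS /allP dyck.
have [||k lek|_] := @weight_dyck n w 0 0 (leqnn 0); rewrite ?add0n //.
  by have := dyck k; rewrite mem_iota /= ltnS => /(_ lek).
by rewrite subnn eqS.
Qed.

Lemma card_shape_matchings n (F : board n) (sigma tau : 'S_3) :
  (one_line sigma, one_line tau) \in listed_pairs -> F \in ferrers_boards n ->
  #|shape_matchings F sigma tau| = 2 ^ (n - board_returns F).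
Proof.
move=> st FF; have := FF; rewrite inE => /andP[_ dyckF].
have sz : size (border F) = n + n.
  have /and3P[/eqP eqE /eqP eqS _] := dyckF.
  rewrite -(count_predC (pred1 east)) eqE; congr (_ + _).
  by rewrite -[RHS]eqS; apply: eq_count => -[].
rewrite -(weight_dyck_path dyckF) -(card_matchings_word st sz).
by apply: eq_card => M; rewrite !inE /has_shape FF eq_sym.
Qed.

(** * Set partitions *)

Lemma connect_first (T : finType) (e : rel T) x y :
  connect e x y -> x = y \/ exists2 z, e x z & connect e z y.
Proof.
case/connectP=> -[|z p] /=; first by left.
by case/andP=> exz path_p ->; right; exists z => //; apply/connectP; exists p.
Qed.

Lemma connect_total (T : finType) (e : rel T) x y z :
  (forall u v v', e u v -> e u v' -> v = v') ->
  connect e x y -> connect e x z -> connect e y z || connect e z y.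
Proof.
move=> fune /connectP[p path_p ->{y}]; elim: p x path_p => [|u p IHp] x /=.
  by move=> _ ->.
case/andP=> exu path_p /connect_first[<-|[v exv vz]].
  by apply/orP; right; apply/connectP; exists (u :: p); rewrite //= exu.
by apply: IHp path_p _; rewrite (fune _ _ _ exu exv).
Qed.

Definition joined n (A : arcs n) : rel 'I_n :=
  let a := [rel i j | (i, j) \in A] in fun i j => connect a i j || connect a j i.

Definition blocks n (A : arcs n) : {set {set 'I_n}} :=
  equivalence_partition (joined A) [set: 'I_n].

Section Blocks.

Variables (n : nat) (A : arcs n).
Hypothesis sysA : arc_system A.
Let a := [rel i j | (i, j) \in A].

Lemma arc_lt i j : a i j -> i < j.
Proof. by have [ltA _ _] := arc_systemP _ sysA; rewrite /a /= -linkedP => /ltA. Qed.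

Lemma arc_fun i j j' : a i j -> a i j' -> j = j'.
Proof.
have [_ funA _] := arc_systemP _ sysA.
by rewrite /a /= -!linkedP => ij /(funA _ _ _ ij)/val_inj.
Qed.

Lemma arc_inj j i i' : a i j -> a i' j -> i = i'.
Proof.
have [_ _ injA] := arc_systemP _ sysA.
by rewrite /a /= -!linkedP => ij /(injA _ _ _ ij)/val_inj.
Qed.

Lemma connect_leq i j : connect a i j -> i <= j.
Proof.
case/connectP=> p path_p ->{j}; elim: p i path_p => //= x p IHp i.
by case/andP=> /arc_lt/ltnW leix /IHp; apply: leq_trans.
Qed.

(** Every point has at most one arc going out and one coming in. Hence two points reached from a
    common point, or reaching a common point, are comparable along the arcs, which gives
    transitivity. *)
Lemma joined_equiv : equivalence_rel (joined A).
Proof.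
have tr i j k : joined A i j -> joined A j k -> joined A i k.
  rewrite /joined -/a => /orP[] cij /orP[] cjk.
  - by rewrite (connect_trans cij cjk).
  - have := @connect_total _ [rel x y | a y x] j i k (@arc_inj).
    by rewrite !(connect_rev a) /= orbC; apply.
  - exact: connect_total arc_fun cij cjk.
  - by rewrite (connect_trans cjk cij) orbT.
have sym i j : joined A i j = joined A j i by rewrite /joined orbC.
move=> i j k; split; first by rewrite /joined connect0.
move=> ij; apply/idP/idP; last exact: tr.
by apply: tr; rewrite sym.
Qed.

Lemma partition_blocks : partition (blocks A) [set: 'I_n].
Proof. by apply: equivalence_partitionP => i j k _ _ _; apply: joined_equiv. Qed.

Lemma mem_pblock_blocks i j : (j \in pblock (blocks A) i) = joined A i j.
Proof.
by apply: pblock_equivalence_partition => // x y z _ _ _; apply: joined_equiv.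
Qed.

End Blocks.

Lemma mem_partition_arcs n (P : {set {set 'I_n}}) i j : partition P [set: 'I_n] ->
  ((i, j) \in partition_arcs P) = [&& i < j, j \in pblock P i
    & [forall l in pblock P i, ~~ (i < l < j)]].
Proof.
case/and3P=> /eqP covP triP _; rewrite inE /=; congr (_ && _).
have iP : i \in cover P by rewrite covP inE.
apply/exists_inP/andP => [[B BP /and3P[iB jB noB]]|[jB noB]].
  by rewrite (def_pblock triP BP iB) jB.
by exists (pblock P i); rewrite ?pblock_mem // mem_pblock iP jB.
Qed.

(** Arcs increase, so a block is a single increasing chain of arcs and its consecutive elements are
    those joined by an arc. *)
Lemma partition_arcs_blocks n (A : arcs n) : arc_system A ->
  partition_arcs (blocks A) = A.
Proof.
move=> sysA; apply/setP=> -[i j]; rewrite mem_partition_arcs ?partition_blocks //.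
rewrite mem_pblock_blocks //; apply/and3P/idP => [[ltij Eij /forall_inP noE]|ijA].
  case/orP: Eij => [|/(connect_leq sysA)]; last by rewrite leqNgt ltij.
  case/connect_first=> [eq_ij|[x ix xj]]; first by rewrite eq_ij ltnn in ltij.
  have := noE x; rewrite mem_pblock_blocks // /joined connect1 // => /(_ isT).
  rewrite (arc_lt sysA ix) /= -leqNgt => lejx.
  suff -> : j = x by [].
  by apply/val_inj/eqP; rewrite eqn_leq lejx (connect_leq sysA xj).
split; first exact: (arc_lt sysA).
  by rewrite /joined connect1.
apply/forall_inP=> l; rewrite mem_pblock_blocks // => /orP[]; last first.
  by move/(connect_leq sysA); rewrite leqNgt => /negPf->.
case/connect_first=> [->|[x ix /(connect_leq sysA) xl]]; first by rewrite ltnn.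
by rewrite -(arc_fun sysA ix ijA) [_ < x]ltnNge xl andbF.
Qed.

Section PartitionArcs.

Variables (n : nat) (P : {set {set 'I_n}}).
Hypothesis partP : partition P [set: 'I_n].

Let triP : trivIset P. Proof. by case/and3P: partP. Qed.

Lemma mem_pblockT i : i \in pblock P i.
Proof. by rewrite mem_pblock; case/and3P: partP => /eqP->. Qed.

Lemma arc_system_partition_arcs : arc_system (partition_arcs P).
Proof.
apply/forall_inP=> -[i j]; rewrite mem_partition_arcs //.
case/and3P=> ltij jB /forall_inP noB.
rewrite ltij /=; apply/forall_inP=> -[k l].
rewrite mem_partition_arcs // => /and3P[ltkl lB /forall_inP noB'] /=.
apply/implyP=> /orP[] /eqP eq_v; subst.
  have := noB l lB; have := noB' j jB; rewrite ltij ltkl /= -!leqNgt => le1 le2.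
  by rewrite xpair_eqE eqxx -val_eqE eqn_leq le1 le2.
have eq_b : pblock P i = pblock P k.
  by rewrite -(same_pblock triP jB) -(same_pblock triP lB).
have := noB k; have := noB' i; rewrite eq_b -{1}eq_b !mem_pblockT.
move=> /(_ isT) le1 /(_ isT) le2; rewrite ltij ltkl !andbT -!leqNgt in le1 le2.
by rewrite xpair_eqE eqxx andbT -val_eqE eqn_leq le1 le2.
Qed.

Lemma joined_partition_arcs i j : joined (partition_arcs P) i j = (j \in pblock P i).
Proof.
have sub k l : connect [rel i j | (i, j) \in partition_arcs P] k l -> l \in pblock P k.
  case/connectP=> p path_p ->{l}; elim: p k path_p => [|x p IHp] k /=.
    by rewrite mem_pblockT.
  case/andP; rewrite mem_partition_arcs // => /and3P[_ xB _] /IHp.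
  by rewrite (same_pblock triP xB).
(* Induction on a bound [d] for the distance: either [k] and [l] are consecutive in their block, or
   an element between them splits the distance. *)
have con d (k l : 'I_n) : l - k < d -> k <= l -> l \in pblock P k ->
    connect [rel i j | (i, j) \in partition_arcs P] k l.
  elim: d k l => // d IHd k l; rewrite ltnS => led.
  rewrite leq_eqVlt => /predU1P[/val_inj-> _|ltkl lB]; first exact: connect0.
  have [/existsP[x /and3P[xB ltkx ltxl]]|/existsPn noB] :=
      boolP [exists x, [&& x \in pblock P k, k < x & x < l]].
    apply: (@connect_trans _ _ x); apply: IHd; rewrite ?(ltnW ltkx) ?(ltnW ltxl) //.
    - by lia.
    - by lia.
    by rewrite (same_pblock triP xB).
  apply: connect1; rewrite /= mem_partition_arcs // ltkl lB /=.
  by apply/forall_inP=> x xB; have := noB x; rewrite xB.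
rewrite /joined; apply/orP/idP => [[/sub //|/sub iB]|jB].
  by rewrite (same_pblock triP iB) mem_pblockT.
have [leij|/ltnW leji] := leqP i j; [left|right]; apply: con (ltnSn _) _ _ => //.
by rewrite (same_pblock triP jB) mem_pblockT.
Qed.

Lemma blocks_partition_arcs : blocks (partition_arcs P) = P.
Proof.
rewrite -[RHS](equivalence_partition_pblock partP); apply: eq_imset => i.
by apply/setP=> j; rewrite !inE joined_partition_arcs.
Qed.

End PartitionArcs.

(** [partition_arcs] is a bijection from set partitions to arc systems, with inverse [blocks]. *)
Lemma card_partitions n k (sigma tau : 'S_k) : #|partitions n sigma tau|
  = #|[set A : arcs n | [&& arc_system A, avoids A sigma & avoids A tau]]|.
Proof.
have inj : {in partitions n sigma tau &, injective (@partition_arcs n)}.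
  move=> P Q; rewrite !inE => /and3P[partP _ _] /and3P[partQ _ _] eqPQ.
  by rewrite -(blocks_partition_arcs partP) eqPQ blocks_partition_arcs.
rewrite -(card_in_imset inj); apply: eq_card => A; rewrite !inE.
apply/imsetP/and3P => [[P + ->]|[sysA avs avt]].
  by rewrite inE => /and3P[partP avs avt]; rewrite arc_system_partition_arcs.
exists (blocks A); rewrite ?partition_arcs_blocks //.
by rewrite inE partition_blocks // partition_arcs_blocks ?avs.
Qed.

(** * Sums over words *)

Fixpoint words (ls : seq letter) m : seq (seq letter) :=
  if m is m'.+1 then [seq l :: w | l <- ls, w <- words ls m'] else [:: [::]].

Lemma mem_words ls m w : (w \in words ls m) = (size w == m) && all [in ls] w.
Proof.
elim: m w => [|m IHm] [|l w] //=.
  by apply/negbTE/allpairsP => -[[? ?] []].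
rewrite eqSS andbCA -IHm; apply/allpairsP/andP => [[[l' w'] /= [? ? [-> ->]]]|[? ?]] //.
by exists (l, w).
Qed.

Lemma words_uniq ls m : uniq ls -> uniq (words ls m).
Proof.
by move=> uls; elim: m => //= m IHm; apply: allpairs_uniq => // -[? ?] [? ?] _ _ /= [-> ->].
Qed.

Definition total_weight ls m e : nat := \sum_(w <- words ls m) weight e 0 w.

Lemma total0 ls e : total_weight ls 0 e = (e == 0).
Proof. by rewrite /total_weight big_seq1. Qed.

Lemma totalS ls m e : total_weight ls m.+1 e = \sum_(l <- ls)
  (if l.2 then minn e 2 * total_weight ls m (e.-1 + l.1) else total_weight ls m (e + l.1)).
Proof.
rewrite /total_weight /= big_allpairs_dep; apply: eq_bigr => -[o c] _ /=.
by case: c => //; rewrite big_distrr.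
Qed.

(** The diagrams are grouped by type word, and [card_diagrams] counts each group. *)
Lemma card_arc_systems m ls (sigma tau : 'S_3) :
  (one_line sigma, one_line tau) \in listed_pairs -> uniq ls ->
  #|[set A : arcs m | [&& arc_system A, all [in ls] (type_word A),
                          avoids A sigma & avoids A tau]]| = total_weight ls m 0.
Proof.
move=> st uls; set S := [set A | _].
transitivity (\sum_(A in S) \sum_(w <- words ls m) (type_word A == w)).
  rewrite -sum1_card; apply: eq_bigr => A; rewrite inE => /and4P[_ allA _ _].
  have := count_uniq_mem (type_word A) (words_uniq m uls).
  rewrite mem_words size_type_word eqxx allA -sum1_count big_mkcond /= => <-.
  by apply: eq_bigr => w _; rewrite eq_sym; case: eqP.
rewrite exchange_big /=; apply: eq_big_seq => w; rewrite mem_words.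
case/andP=> /eqP sz_w all_w; rewrite -(card_diagrams st sz_w) -big_mkcondr sum1_card.
apply: eq_card => A; rewrite unfold_in /S !inE.
by case: (type_word A =P w) => [->|_]; rewrite ?all_w !(andbT, andbF).
Qed.

Definition matching_letters : seq letter := [:: (true, false); (false, true)].
Definition partition_letters : seq letter :=
  [:: (false, false); (true, false); (false, true); (true, true)].

Lemma card_matchings n (sigma tau : 'S_3) :
  (one_line sigma, one_line tau) \in listed_pairs ->
  #|matchings n sigma tau| = total_weight matching_letters (n + n) 0.
Proof.
move=> st; rewrite -(card_arc_systems (n + n) st) //; apply: eq_card => M.
rewrite !inE perfect_matchingE -!andbA; congr [&& _, _ & _].
by apply: eq_all => -[[] []].
Qed.

Lemma card_partitions_total n (sigma tau : 'S_3) :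
  (one_line sigma, one_line tau) \in listed_pairs ->
  #|partitions n sigma tau| = total_weight partition_letters n 0.
Proof.
move=> st; rewrite card_partitions -(card_arc_systems n st) //; apply: eq_card => A.
rewrite !inE; case: (arc_system A) => //=; rewrite (_ : all _ _ = true) //.
by apply/allP=> -[[] []].
Qed.

Lemma total_matching m e : total_weight matching_letters m.+1 e =
  total_weight matching_letters m e.+1 + minn e 2 * total_weight matching_letters m e.-1.
Proof. by rewrite totalS !big_cons big_nil /= addn1 !addn0. Qed.

Lemma total_partition m e : total_weight partition_letters m.+1 e =
  total_weight partition_letters m e + total_weight partition_letters m e.+1
  + minn e 2 * (total_weight partition_letters m e.-1 + total_weight partition_letters m e).
Proof.
rewrite totalS !big_cons big_nil /= !addn0 addn1 mulnDr !addnA.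
by case: e => [|e]; rewrite ?min0n ?mul0n //= addn1.
Qed.

(** A letter lowers the height by at most one, so [m] letters cannot bring it from [e] down to 0. *)
Lemma total_matching_small m e : m < e -> total_weight matching_letters m e = 0.
Proof.
elim: m e => [|m IHm] e lt_me; first by rewrite total0; case: e lt_me.
by rewrite total_matching !IHm ?muln0 //; lia.
Qed.

(** * Generating functions *)

Local Open Scope ring_scope.

Local Notation X := fps_X.

Lemma fps_coefD f g n : coef (f + g) n = coef f n + coef g n.
Proof. by []. Qed.

Lemma fps_coefN f n : coef (- f) n = - coef f n.
Proof. by []. Qed.

Lemma fps_coef_natr k n : coef (k%:R : fps) n = if n == 0%N then k%:R else 0.
Proof.
elim: k => [|k IHk]; first by case: n.
rewrite -natr1 fps_coefD IHk fps_coef1.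
by case: n {IHk} => [|n]; rewrite ?addr0 ?natr1.
Qed.

Lemma fps_coef_natrM k f n : coef (k%:R * f) n = k%:R * coef f n.
Proof.
rewrite fps_coefM big_ord_recl fps_coef_natr /= subn0 big1 ?addr0 // => i _.
by rewrite fps_coef_natr mul0r.
Qed.

Lemma fps_coefXM f n : coef (X * f) n = if n is m.+1 then coef f m else 0.
Proof.
case: n => [|n]; rewrite fps_coefM; first by rewrite big_ord1 mul0r.
rewrite big_ord_recl mul0r add0r big_ord_recl /= mul1r subSS subn0.
by rewrite big1 ?addr0 // => i _; rewrite mul0r.
Qed.

Lemma fps_coef_exp0 f n : coef (f ^+ n) 0 = coef f 0 ^+ n.
Proof.
by elim: n => // n IHn; rewrite !exprS fps_coefM big_ord1 subn0 IHn.
Qed.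

Lemma fps_coefM0 f g : coef (f * g) 0 = coef f 0 * coef g 0.
Proof. by rewrite fps_coefM big_ord1. Qed.

Lemma fps_unit_coef0 f c : coef f 0 = c -> c != 0 -> f \is a GRing.unit.
Proof. by move=> <-; rewrite fps_unitE. Qed.

Lemma fps_natr_unit k : (k.+1%:R : fps) \is a GRing.unit.
Proof.
by rewrite fps_unitE fps_coef_natr /= pnatr_eq0.
Qed.

Definition coef0E := (fps_coefD, fps_coefN, fps_coefM0, fps_coef_natr, fps_coef_exp0,
  fps_coef1).

(** * Weighted Dyck paths and the Catalan series *)

Section Matchings.

Let s := fps_sqrt (1 - 8 * X).
(** Twice the Catalan series evaluated at [2 * X], in view of [g = 2 + X * g ^+ 2]. *)
Let g := 4 / (1 + s).
Let v := (3 + s)^-1.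

Let sE : s ^+ 2 = 1 - 8 * X.
Proof. by apply: fps_sqrtK; rewrite !coef0E /= mulr0 subr0. Qed.

Let unit_1s : 1 + s \is a GRing.unit.
Proof. by apply: (@fps_unit_coef0 _ 2); rewrite ?coef0E. Qed.

Let unit_3s : 3 + s \is a GRing.unit.
Proof. by apply: (@fps_unit_coef0 _ 4); rewrite ?coef0E. Qed.

Lemma sqrt_1_8XE : s = 1 - 2 * X * g.
Proof.
have gs : g * (1 + s) = 4 by rewrite /g divrK.
(* Both sides are multiplied by 4; the difference then combines the two equations known for [s] and
   [g]. *)
apply: (mulrI (fps_natr_unit 3)); apply/eqP; rewrite -subr_eq0; apply/eqP.
transitivity (g * (s ^+ 2 - 1 + 8 * X) + (4 - g * (1 + s)) * (s - 1)); first by ring.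
by rewrite sE gs; ring.
Qed.

Let gE : g = 2 + X * g ^+ 2.
Proof.
have gs : g * (1 + s) = 4 by rewrite /g divrK.
apply: (mulrI (fps_natr_unit 1)); apply/eqP; rewrite -subr_eq0; apply/eqP.
transitivity (g * (1 + (1 - 2 * X * g)) - 4); first by ring.
by rewrite -sqrt_1_8XE gs subrr.
Qed.

Let vE : v * (4 - 2 * X * g) = 1.
Proof.
have -> : 4 - 2 * X * g = 3 + s by rewrite sqrt_1_8XE; ring.
by rewrite /v mulVr.
Qed.

(** [X] marks east steps: [n] of them starting at height [e] give length [n.*2 + e]. From height 2
    on the recurrence has constant coefficients, and powers of [g] solve it. *)
Let height_series e : fps := if e is e'.+1 then 2 * g * v * g ^+ e' else 4 * v.

Let height_seriesE e : height_series e =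
  (e == 0%N)%:R + X * height_series e.+1 + (minn e 2)%:R * height_series e.-1.
Proof.
case: e => [|[|e]] /=.
- rewrite min0n mul0r addr0 expr0 mulr1; apply/eqP; rewrite -subr_eq0; apply/eqP.
  transitivity (v * (4 - 2 * X * g) - 1); first by ring.
  by rewrite vE subrr.
- rewrite (_ : minn 1 2 = 1%N) // expr0 expr1 add0r mulr1; apply/eqP;
    rewrite -subr_eq0; apply/eqP.
  transitivity (2 * v * (g - (2 + X * g ^+ 2))); first by ring.
  by rewrite -gE; ring.
rewrite (_ : minn _ _ = 2)%N; last by lia.
rewrite add0r; apply/eqP; rewrite -subr_eq0; apply/eqP; rewrite !exprS.
transitivity (2 * v * g * g ^+ e * (g - (2 + X * g ^+ 2))); first by ring.
by rewrite -gE; ring.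
Qed.

Let total_matching_series n e :
  (total_weight matching_letters (n.*2 + e) e)%:R = coef (height_series e) n.
Proof.
(* The induction is on the length, because a south step lowers [e] but leaves [n] unchanged. *)
have [m] := ubnP (n.*2 + e); elim: m n e => // m IHm n e; rewrite ltnS => lem.
rewrite height_seriesE !fps_coefD fps_coefXM fps_coef_natrM.
case eqN: (n.*2 + e)%N => [|N].
  have [-> ->] : n = 0%N /\ e = 0%N by split; lia.
  by rewrite total0 mul0r !addr0.
have -> : coef (e == 0%N)%:R n = 0.
  rewrite fps_coef_natr; case: n e eqN {lem} => [|n] [|e] //.
rewrite add0r total_matching natrD natrM; congr (_ + _).
  case: n eqN lem => [|n] eqN lem; first by rewrite total_matching_small //; lia.
  rewrite -IHm; last by lia.
  by congr (total_weight _ _ _)%:R; lia.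
case: e eqN lem => [|e] eqN lem; first by rewrite min0n !mul0r.
by congr (_ * _); rewrite -IHm; [congr (total_weight _ _ _)%:R|]; lia.
Qed.

Lemma total_matching_ogf : ogf (fun n => total_weight matching_letters (n + n) 0)
  = 4 / (3 + fps_sqrt (1 - 8 * X)).
Proof.
apply/fpsP=> n /=; rewrite -[RHS](total_matching_series n 0).
by rewrite addn0 addnn.
Qed.

(** Coefficientwise form of [(1 + X) * (4 * v) = 1 + X * g]. *)
Lemma total_matching_rec n :
  (total_weight matching_letters (n.+1 + n.+1) 0)%:R =
  coef (4 / (1 + fps_sqrt (1 - 8 * X))) n - (total_weight matching_letters (n + n) 0)%:R.
Proof.
have ogfE k : (total_weight matching_letters (k + k) 0)%:R = coef (4 * v) k.
  by rewrite -(total_matching_series k 0) addn0 addnn.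
rewrite !ogfE; apply/eqP; rewrite eq_sym subr_eq; apply/eqP.
have : (1 + X) * (4 * v) = 1 + X * g.
  apply: (mulrI unit_3s); rewrite (_ : 3 + s = 4 - 2 * X * g);
    last by rewrite sqrt_1_8XE; ring.
  transitivity (4 * (1 + X) * (v * (4 - 2 * X * g))); first by ring.
  rewrite vE; apply/eqP; rewrite -subr_eq0; apply/eqP.
  transitivity (-2 * X * (g - (2 + X * g ^+ 2))); first by ring.
  by rewrite -gE; ring.
move/fpsP/(_ n.+1); rewrite mulrDl mul1r !fps_coefD !fps_coefXM fps_coef1 add0r.
by move=> <-.
Qed.

End Matchings.

(** * Weighted paths with level steps and the Schroeder series *)

Section Partitions.

Let s := fps_sqrt (1 - 6 * X + X ^+ 2).
(** Twice the series of the little Schroeder numbers 1, 3, 11, 45; [X * h] is the ratio of the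
    geometric solution. *)
Let h := 4 / (1 - 3 * X + s).
(** The determinant of the equations at heights 0 and 1, once the series at height 2 is replaced by
    [X * h] times the one at height 1. *)
Let d := (1 - X) * (1 - 2 * X - X ^+ 2 * h) - X ^+ 2.

Let sE : s ^+ 2 = 1 - 6 * X + X ^+ 2.
Proof. by apply: fps_sqrtK; rewrite !coef0E /= expr0n mulr0 subr0 addr0. Qed.

Let hs : h * (1 - 3 * X + s) = 4.
Proof.
by rewrite divrK // (@fps_unit_coef0 _ 2) // !coef0E /= mulr0 subr0.
Qed.

Let shE : s = 1 - 3 * X - 2 * X ^+ 2 * h.
Proof.
apply: (mulrI (fps_natr_unit 3)); apply/eqP; rewrite -subr_eq0; apply/eqP.
transitivity (h * (s ^+ 2 - (1 - 6 * X + X ^+ 2))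
  + (4 - h * (1 - 3 * X + s)) * (s - (1 - 3 * X))); first by ring.
by rewrite sE hs; ring.
Qed.

Let hE : X ^+ 2 * h ^+ 2 - h + 2 + 3 * X * h = 0.
Proof.
apply: (mulrI (fps_natr_unit 1)); rewrite mulr0.
transitivity (4 - h * (1 - 3 * X + (1 - 3 * X - 2 * X ^+ 2 * h))); first by ring.
by rewrite -shE hs subrr.
Qed.

Let unit_d : d \is a GRing.unit.
Proof.
by apply: (@fps_unit_coef0 _ 1); rewrite // !coef0E /= expr0n !(mulr0, mul0r, subr0) mulr1.
Qed.

Let height_series e : fps :=
  if e is e'.+1 then X / d * (X * h) ^+ e' else (1 - 2 * X - X ^+ 2 * h) / d.

Let height_seriesE e : height_series e = (e == 0%N)%:R
  + X * (height_series e + height_series e.+1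
         + (minn e 2)%:R * (height_series e.-1 + height_series e)).
Proof.
have dV : d / d = 1 by rewrite divrr.
case: e => [|[|e]] /=.
- rewrite min0n mul0r addr0 expr0 mulr1; apply/eqP; rewrite -subr_eq0; apply/eqP.
  transitivity (((1 - X) * (1 - 2 * X - X ^+ 2 * h) - X ^+ 2) / d - 1);
    first by ring.
  by rewrite -/d dV subrr.
- rewrite (_ : minn 1 2 = 1%N) // expr0 expr1 add0r mulr1.
  apply/eqP; rewrite -subr_eq0; apply/eqP; ring.
rewrite (_ : minn _ _ = 2)%N; last by lia.
rewrite add0r; apply/eqP; rewrite -subr_eq0; apply/eqP; rewrite !exprS.
transitivity (- X ^+ 2 / d * (X * h) ^+ e
   * (X ^+ 2 * h ^+ 2 - h + 2 + 3 * X * h)); first by ring.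
by rewrite hE mulr0.
Qed.

Let total_partition_series n e :
  (total_weight partition_letters n e)%:R = coef (height_series e) n.
Proof.
elim: n e => [|n IHn] e; rewrite height_seriesE !fps_coefD fps_coefXM.
  by rewrite total0 fps_coef_natr addr0.
rewrite fps_coef_natr add0r !fps_coefD fps_coef_natrM fps_coefD -!IHn.
by rewrite total_partition !natrD natrM natrD.
Qed.

Lemma total_partition_ogf : ogf (fun n => total_weight partition_letters n 0)
  = (2 - 3 * X + X ^+ 2 - X * fps_sqrt (1 - 6 * X + X ^+ 2))
    / (2 * (1 - 3 * X + 3 * X ^+ 2)).
Proof.
have -> : ogf (fun n => total_weight partition_letters n 0) = height_series 0.
  by apply/fpsP=> n; rewrite -total_partition_series.
have unit_r : 2 * (1 - 3 * X + 3 * X ^+ 2) \is a GRing.unit.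
  apply: (@fps_unit_coef0 _ 2); rewrite // !coef0E /=.
  by rewrite expr0n !(mulr0, subr0, addr0, mulr1).
apply: (mulIr unit_r); apply: (mulIr unit_d).
rewrite divrK // mulrAC /height_series divrK // -/s shE.
apply/eqP; rewrite -subr_eq0; apply/eqP.
(* After clearing denominators and eliminating [s], the difference is a multiple of the quadratic
   relation for [h]. *)
transitivity (2 * (X ^+ 3 - X ^+ 4) * (X ^+ 2 * h ^+ 2 - h + 2 + 3 * X * h));
  last by rewrite hE mulr0.
rewrite /d; ring.
Qed.

End Partitions.

(** * The closed formula for matchings *)

Definition fps_deriv (f : fps) : fps := Fps (fun n => coef f n.+1 *+ n.+1).

Lemma fps_derivM f g : fps_deriv (f * g) = fps_deriv f * g + f * fps_deriv g.
Proof.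
apply/fpsP=> n; rewrite fps_coefD !fps_coefM.
(* The product rule is borrowed from polynomials; length [n.+2] keeps the coefficient of index
   [n.+1] that the derivative reads. *)
transitivity ((truncate n.+2 f * truncate n.+2 g)^`()`_n).
  by rewrite coef_deriv -coef_fps_mul.
rewrite derivM coefD !coefM.
congr (_ + _); apply: eq_bigr => i _; rewrite coef_deriv !coef_poly;
  have := ltn_ord i => lti; rewrite !ifT //; lia.
Qed.

(** Differentiating [s ^+ 2 = 1 - 8 * X] gives [(1 - 8 * X) * s' = - 4 * s], whose coefficients obey
    this recurrence. *)
Lemma coef_sqrt_rec n :
  n.+1%:R * coef (fps_sqrt (1 - 8 * X)) n.+1
  = (8 * n%:R - 4) * coef (fps_sqrt (1 - 8 * X)) n.
Proof.
set s := fps_sqrt _; have sE : s ^+ 2 = 1 - 8 * X.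
  by apply: fps_sqrtK; rewrite !coef0E /= mulr0 subr0.
clearbody s; have ds : s * fps_deriv s = - 4.
  apply: (mulrI (fps_natr_unit 1)).
  transitivity (fps_deriv (s ^+ 2)); first by rewrite expr2 fps_derivM; ring.
  rewrite sE; apply/fpsP=> k; rewrite (_ : 2 * - 4 = - 8 :> fps); last by ring.
  transitivity (coef (1 - 8 * X) k.+1 *+ k.+1) => //.
  rewrite fps_coefD !fps_coefN fps_coef_natrM !fps_coef_natr fps_coef1.
  by case: k => [|k] /=; rewrite ?mulr1 ?mulr0 ?oppr0 add0r ?mul0rn.
have : (1 - 8 * X) * fps_deriv s = - 4 * s.
  by rewrite -sE expr2 -mulrA ds mulrC.
move/fpsP/(_ n); rewrite mulrBl mul1r -mulrA fps_coefD fps_coefN !fps_coef_natrM.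
rewrite mulNr fps_coefN fps_coef_natrM fps_coefXM /fps_deriv /=.
rewrite (mulr_natl (coef s n.+1)); case: n => [|n];
  first by rewrite mulr0 subr0 => ->; ring.
move/eqP; rewrite subr_eq => /eqP ->; ring.
Qed.

Lemma central_bin_rec n : (n.+1 * 'C(2 * n.+1, n.+1) = 2 * (2 * n).+1 * 'C(2 * n, n))%N.
Proof.
have eq1 := mul_bin_diag (2 * n).+2 n; have /= eq2 := mul_bin_diag (2 * n).+1 n.
have eq3 : 'C((2 * n).+1, n.+1) = 'C((2 * n).+1, n).
  by rewrite -bin_sub; [congr 'C(_, _)|]; lia.
rewrite eq3 in eq2; rewrite (_ : 2 * n.+1 = (2 * n).+2)%N; last by lia.
by rewrite -eq1 -mulnA eq2 mulnA; congr (_ * _)%N; lia.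
Qed.

(** The coefficient is [2 ^ n.+1] times a Catalan number: the recurrence of the square root passes
    to the series and matches that of the central binomials. *)
Lemma coef_catalan n : n.+1%:R * coef (4 / (1 + fps_sqrt (1 - 8 * X))) n
  = (2 ^ n.+1 * 'C(2 * n, n))%:R.
Proof.
set g := 4 / _; have sg k : coef (fps_sqrt (1 - 8 * X)) k.+1 = - (2 * coef g k).
  rewrite {1}sqrt_1_8XE -/g -mulrA fps_coefD fps_coefN fps_coef_natrM fps_coefXM.
  by rewrite fps_coef1 sub0r.
elim: n => [|n IHn].
  have := coef_sqrt_rec 0; rewrite sg fps_sqrt0.
  rewrite mulr1 => rec; rewrite (_ : coef g 0 = 2) //.
  apply: (@mulfI _ (- 2)) => //.
  transitivity (1%:R * - (2 * coef g 0)); first by ring.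
  by rewrite rec; ring.
have := coef_sqrt_rec n.+1; rewrite !sg => rec.
apply: (@mulfI _ n.+1%:R); first by rewrite pnatr_eq0.
rewrite -natrM (_ : n.+1 * _ = 4 * (2 * n).+1 * (2 ^ n.+1 * 'C(2 * n, n)))%N;
  last by rewrite mulnCA central_bin_rec expnS; ring.
rewrite natrM -IHn.
have {rec} -> : n.+2%:R * coef g n.+1 = (8 * n.+1%:R - 4) * coef g n.
  by apply: (@mulfI _ (- 2)) => //; rewrite mulrCA mulNr rec; ring.
by ring.
Qed.

(** Writes the summand of the closed formula as a factor free of [k] times ['C(n, k)] over two
    consecutive integers; multiplied by factorials, both sides become [(2 * n + 2)! * (n + k)!]. *)
Lemma bin_product n k : (k <= n)%N ->
  ('C(2 * n + 2, n - k) * 'C(n + k, k) * ((n + k).+1 * (n + k).+2)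
   = 'C(2 * n + 2, n.+1) * n.+1 ^ 2 * 'C(n, k))%N.
Proof.
move=> lekn; have := bin_fact lekn.
have := @bin_fact (2 * n + 2) (n - k); have := @bin_fact (n + k) k.
have := @bin_fact (2 * n + 2) n.+1.
rewrite (_ : 2 * n + 2 - n.+1 = n.+1)%N; last by lia.
rewrite (_ : 2 * n + 2 - (n - k) = (n + k).+2)%N; last by lia.
rewrite addnK !factS => /(_ _)H1 /(_ _)H2 /(_ _)H3 H4.
have {}H1 := H1 ltac:(lia); have {}H2 := H2 ltac:(lia); have {}H3 := H3 ltac:(lia).
have pos : (0 < (n - k)`! * k`! * n`! * (n + k)`!)%N by rewrite !muln_gt0 !fact_gt0.
apply/eqP; rewrite -(eqn_pmul2r pos); apply/eqP.
transitivity ((2 * n + 2)`! * (n + k)`!)%N.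
  by rewrite -H3 -{3}H2; ring.
by rewrite -H1 -H4; ring.
Qed.

(** The integral of [(1 - x) * x ^ n * (1 + x) ^ n] over the interval from 0 to 1, expanded by the
    binomial theorem. *)
Definition bin_integral n : rat :=
  \sum_(0 <= k < n.+1) 'C(n, k)%:R / ((n + k).+1 * (n + k).+2)%:R.

Lemma bin_sumE n : n.+1%:R^-1 * \sum_(0 <= k < n.+1) ('C(2 * n + 2, n - k) * 'C(n + k, k))%:R
  = 'C(2 * n.+1, n.+1)%:R * n.+1%:R * bin_integral n :> rat.
Proof.
rewrite /bin_integral !mulr_sumr; apply: eq_big_nat => k; rewrite ltnS => /andP[_ lekn].
have nz : ((n + k).+1 * (n + k).+2)%:R != 0 :> rat by rewrite pnatr_eq0.
have nz' : n.+1%:R != 0 :> rat by rewrite pnatr_eq0.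
have -> : ('C(2 * n + 2, n - k) * 'C(n + k, k))%:R
    = 'C(2 * n.+1, n.+1)%:R * n.+1%:R ^+ 2 * 'C(n, k)%:R
      / ((n + k).+1 * (n + k).+2)%:R :> rat.
  apply: (canRL (mulfK nz)); rewrite -natrM bin_product // -natrX -!natrM.
  by rewrite (_ : 2 * n.+1 = 2 * n + 2)%N //; lia.
move: (_%:R : rat) nz' => x nzx; move: (_%:R : rat) nz => d nzd.
by field; rewrite nzx nzd.
Qed.

Lemma bin_integral_rec n :
  2 * (2 * n + 3)%:R * bin_integral n.+1 + n.+1%:R * bin_integral n
  = 2 ^+ n.+2 / n.+2%:R.
Proof.
(* A telescoping certificate: [G] vanishes at 0 through its factor [k] and at [n.+2] through its
   binomial coefficient. What remains is a sum of the ['C(n.+1, k)]. *)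
pose G k : rat := (k * 'C(n.+1, k) * (k + 3 * n + 5))%:R
  / (n.+2 * ((n + k).+1 * (n + k).+2))%:R.
have sum_bin : \sum_(0 <= k < n.+2) 'C(n.+1, k)%:R = 2 ^+ n.+1 :> rat.
  rewrite -natr_sum -natrX -[2%N]/(1 + 1)%N expnDn big_mkord; congr _%:R.
  by apply: eq_bigr => i _; rewrite !exp1n !muln1.
(* The added term is zero and gives both sums the same range. *)
have -> : bin_integral n = \sum_(0 <= k < n.+2) 'C(n, k)%:R / ((n + k).+1 * (n + k).+2)%:R.
  by rewrite [RHS]big_nat_recr //= bin_small // mul0r addr0.
transitivity (\sum_(0 <= k < n.+2) (2 / n.+2%:R * 'C(n.+1, k)%:R + (G k.+1 - G k))).
  rewrite /bin_integral !mulr_sumr -big_split; apply: eq_big_nat => k.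
  rewrite ltnS => /andP[_ lekn].
  have nz m : m.+1%:R != 0 :> rat by rewrite pnatr_eq0.
  have eq1 : 'C(n.+1, k.+1)%:R = (n.+1%:R - k%:R) * 'C(n.+1, k)%:R / k.+1%:R :> rat.
    apply: (canRL (mulfK (nz k))).
    by rewrite -natrB // -!natrM mulnC mul_bin_left.
  have eq2 : 'C(n, k)%:R = (n.+1%:R - k%:R) * 'C(n.+1, k)%:R / n.+1%:R :> rat.
    apply: (canRL (mulfK (nz n))).
    by rewrite -natrB // -!natrM mulnC -(mul_bin_down n.+1).
  rewrite /G !(natrM, eq1, eq2) /=.
  move: ('C(n.+1, k)%:R : rat) => c.
  by field; rewrite -!natrD !nat1r -!natrD !pnatr_eq0.
rewrite big_split -mulr_sumr sum_bin telescope_sumr //= /G mul0n mul0r bin_small //.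
by rewrite muln0 !mul0n !mul0r subrr addr0 [in RHS]exprS mulrAC.
Qed.

(** Both sides have the same first term and the same sums of consecutive terms: for the left side by
    [total_matching_rec], for the right by [bin_integral_rec] scaled with the central binomial
    recurrence. *)
Lemma total_matching_sum n : (total_weight matching_letters (n.+1 + n.+1) 0)%:R
  = n.+1%:R^-1 * \sum_(0 <= k < n.+1) ('C(2 * n + 2, n - k) * 'C(n + k, k))%:R :> rat.
Proof.
rewrite bin_sumE; elim: n => [|n IHn].
  rewrite /bin_integral big_nat1 total_matching_rec total0.
  have := coef_catalan 0; rewrite mul1r => ->.
  by apply/eqP.
rewrite total_matching_rec IHn; apply/eqP; rewrite subr_eq; apply/eqP.
have nz : n.+2%:R != 0 :> rat by rewrite pnatr_eq0.
apply: (mulfI nz); rewrite coef_catalan natrM natrX.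
have := bin_integral_rec n.
have : (n.+2%:R : rat) * 'C(2 * n.+2, n.+2)%:R = 2 * (2 * n + 3)%:R * 'C(2 * n.+1, n.+1)%:R.
  by rewrite -!natrM central_bin_rec; congr (_ * _)%:R; lia.
move=> eq1 eq2; rewrite mulrDr !mulrA eq1.
transitivity (n.+2%:R * 'C(2 * n.+1, n.+1)%:R * (2 ^+ n.+2 / n.+2%:R) : rat).
  move: (n.+2%:R : rat) nz => a nz_a.
  by field.
by rewrite -eq2; ring.
Qed.

Theorem theorem6p1 (sigma tau : 'S_3)
    (hpair : (one_line sigma, one_line tau) \in listed_pairs) :
  [/\ forall (n : nat) (F : board n), F \in ferrers_boards n ->
        #|shape_matchings F sigma tau| = (2 ^ (n - board_returns F))%N,
      forall sigma' tau' : 'S_3,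
        (one_line sigma', one_line tau') \in listed_pairs ->
        shape_Wilf_equivalent sigma tau sigma' tau',
      ogf (fun n => #|matchings n sigma tau|)
        = 4 / (3 + fps_sqrt (1 - 8 * fps_X)),
      forall n : nat,
        (#|matchings n.+1 sigma tau|)%:R
          = (n.+1)%:R^-1
            * \sum_(0 <= k < n.+1) ('C(2 * n + 2, n - k) * 'C(n + k, k))%:R
          :> rat
    & ogf (fun n => #|partitions n sigma tau|)
        = (2 - 3 * fps_X + fps_X ^+ 2
             - fps_X * fps_sqrt (1 - 6 * fps_X + fps_X ^+ 2))
          / (2 * (1 - 3 * fps_X + 3 * fps_X ^+ 2)) ].
Proof.
split=> [n F FF|sigma' tau' hpair' n F ferF||n|].
- exact: card_shape_matchings.
- have [FF|NFF] := boolP (F \in ferrers_boards n).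
    by rewrite !card_shape_matchings.
  (* A Ferrers board whose border is not a Dyck path is the shape of no matching, so both counts are
     zero. *)
  have empty s t : #|shape_matchings F s t| = 0%N :> nat.
    by apply: eq_card0 => M; rewrite inE /has_shape (negPf NFF) andbF.
  by rewrite !empty.
- rewrite -total_matching_ogf; apply/fpsP=> n /=.
  by rewrite card_matchings.
- by rewrite card_matchings // total_matching_sum.
- rewrite -total_partition_ogf; apply/fpsP=> n /=.
  by rewrite card_partitions_total.
Qed.
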